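(* Let $b\in L^\infty_\sharp(Y_d)^d$ be a periodic vector field. Assume that for some $k\in\{1,\dots,d\}$ there exist two measurable subsets $A_k,B_k$ of $[0,1]$ with positive Lebesgue measure such that, writing $x=(x_k,x')$ with $x'\in\mathbb{R}^{d-1}$ the remaining coordinates, $$\begin{cases}\forall\,x_k\in A_k,\quad b_k(x_k,x')>0 & \text{for a.e. }x'\in\mathbb{R}^{d-1},\\ \forall\,x_k\in B_k,\quad b_k(x_k,x')<0 & \text{for a.e. }x'\in\mathbb{R}^{d-1}.\end{cases}$$ Then the vector field $b$ has no positive invariant measure $\sigma\in L^\infty_\sharp(Y_d)$.
   Context: $Y_d:=[0,1)^d$; a function $f$ on $\mathbb{R}^d$ is $Y_d$-periodic if $f(x+\kappa)=f(x)$ for all $\kappa\in\mathbb{Z}^d$. $L^\infty_\sharp(Y_d)$ is the space of $Y_d$-periodic functions in $L^\infty_{\rm loc}(\mathbb{R}^d)$. A positive invariant measure of $b$ in $L^\infty_\sharp(Y_d)$ is a function $\sigma\in L^\infty_\sharp(Y_d)$, positive a.e., such that $\mathrm{div}(\sigma b)=0$ in $\mathbb{R}^d$ in the sense of distributions. Here $b_k$ denotes the $k$-th component of $b$. *)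

(* Defs.v *)
From HB Require Import structures.
From mathcomp Require Import all_boot all_order all_algebra.
From mathcomp Require Import all_classical all_reals all_analysis.
Set Implicit Arguments.
Unset Strict Implicit.
Unset Printing Implicit Defensive.
Import Order.TTheory GRing.Theory Num.Theory.
Import numFieldNormedType.Exports.
Local Open Scope classical_set_scope.
Local Open Scope ring_scope.

(* With 'rV[R]_d as R^d, insert_coord k t x' is the point (x_k, x') with k-th
   coordinate x_k = t and remaining coordinates x', in increasing order. *)
Definition insert_coord (T : Type) (d : nat) (k : 'I_d) (t : T)
    (x' : 'rV[T]_d.-1) : 'rV[T]_d :=
  \row_i (if unlift k i is Some j then x' ord0 j else t).

Section measurable_rV.
Context {R : realType}.

(* The sigma-algebra generated by the coordinates is the Borel one. *)
Let coord_rV n : 'I_n -> 'rV[R]_n -> R := fun i x => x ord0 i.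

Let rV_set0 n : g_sigma_preimage (@coord_rV n) set0.
Proof. exact: sigma_algebra0. Qed.

Let rV_setC n A :
  g_sigma_preimage (@coord_rV n) A -> g_sigma_preimage (@coord_rV n) (~` A).
Proof. exact: sigma_algebraC. Qed.

Let rV_bigcup n (F : _^nat) :
  (forall i, g_sigma_preimage (@coord_rV n) (F i)) ->
  g_sigma_preimage (@coord_rV n) (\bigcup_i (F i)).
Proof. exact: sigma_algebra_bigcup. Qed.

HB.instance Definition _ n := @isMeasurable.Build default_measure_display
  'rV[R]_n (g_sigma_preimage (@coord_rV n))
  (@rV_set0 n) (@rV_setC n) (@rV_bigcup n).

Lemma measurable_coord_rV n (i : 'I_n) :
  measurable_fun [set: 'rV[R]_n] (fun x => x ord0 i).
Proof.
move=> _ Y mY; rewrite setTI; apply: sub_sigma_algebra => /=.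
rewrite -bigcup_seq/=; exists i => /=; first by rewrite mem_index_enum.
by exists Y => //; rewrite setTI.
Qed.

Lemma measurable_fun_rV d (T : measurableType d) n (f : T -> 'rV[R]_n) :
  (forall i, measurable_fun setT (fun x => f x ord0 i)) ->
  measurable_fun setT f.
Proof.
move=> mf.
have sub : g_sigma_preimage (fun i => @coord_rV n i \o f) `<=` measurable.
  apply: smallest_sub; first exact: sigma_algebra_measurable.
  rewrite -bigcup_seq/=; apply: bigcup_sub => i _ A [B mB <-].
  exact: mf.
move=> _ A mA; apply: sub.
by rewrite g_sigma_preimage_comp; exists A.
Qed.

End measurable_rV.

Section borel_lebesgue.
Context {R : realType}.

Definition cons_rV n (p : measurableTypeR R * 'rV[R]_n) : 'rV[R]_n.+1 :=
  insert_coord ord0 p.1 p.2.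

Lemma measurable_cons_rV n : measurable_fun setT (@cons_rV n).
Proof.
apply: measurable_fun_rV => i; rewrite /cons_rV /insert_coord.
have [j ij|i0] := unliftP ord0 i.
- rewrite (_ : (fun _ => _) =
    (fun x : 'rV[R]_n => x ord0 j) \o (@snd (measurableTypeR R) _)).
    apply: measurableT_comp; first exact: measurable_coord_rV.
    exact: measurable_snd.
  by apply/funext => x; rewrite mxE ij liftK.
- rewrite (_ : (fun _ => _) = (@fst (measurableTypeR R) 'rV[R]_n)).
    exact: measurable_fst.
  by apply/funext => x; rewrite mxE i0 unlift_none.
Qed.

HB.instance Definition _ n := isMeasurableFun.Build _ _ _ _ (@cons_rV n)
  (@measurable_cons_rV n).

Section step.
Variables (n : nat) (mu : {sigma_finite_measure set 'rV[R]_n -> \bar R}).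

Definition borel_lebesgueS : set 'rV[R]_n.+1 -> \bar R :=
  pushforward (lebesgue_measure \x mu)%E (@cons_rV n).

Let muS0 : borel_lebesgueS set0 = 0%E.
Proof. exact: measure0. Qed.

Let muS_ge0 A : (0 <= borel_lebesgueS A)%E.
Proof. exact: measure_ge0. Qed.

Let muS_sigma_additive : semi_sigma_additive borel_lebesgueS.
Proof. exact: measure_semi_sigma_additive. Qed.

HB.instance Definition _ := isMeasure.Build _ _ _ borel_lebesgueS
  muS0 muS_ge0 muS_sigma_additive.

Let split_rV (x : 'rV[R]_n.+1) : measurableTypeR R * 'rV[R]_n :=
  (x ord0 ord0, \row_j x ord0 (lift ord0 j)).

Let muS_sigma_finite : sigma_finite setT borel_lebesgueS.
Proof.
have split_consK p : split_rV (cons_rV p) = p.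
  case: p => t x; rewrite /split_rV /cons_rV /insert_coord mxE unlift_none /=.
  by congr pair; apply/rowP => j; rewrite !mxE liftK.
have msplit : measurable_fun setT split_rV.
  apply: measurable_fun_pair; first exact: measurable_coord_rV.
  apply: measurable_fun_rV => j.
  rewrite (_ : (fun _ => _) = (fun x : 'rV[R]_n.+1 => x ord0 (lift ord0 j))).
    exact: measurable_coord_rV.
  by apply/funext => x; rewrite mxE.
have /sigma_finiteP[F [FT ndF Foo]] := sigma_finiteT (@lebesgue_measure R).
have /sigma_finiteP[G [GT ndG Goo]] := sigma_finiteT mu.
exists (fun k => split_rV @^-1` (F k `*` G k)).
  rewrite -preimage_bigcup -(preimage_setT split_rV); congr (_ @^-1` _).
  apply/esym/seteqP; split => // -[t x] _.
  have [n1 _ Ft] : (\bigcup_i F i) t by rewrite -FT.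
  have [n2 _ Gx] : (\bigcup_i G i) x by rewrite -GT.
  exists (maxn n1 n2) => //; split.
  - by move: (t) Ft; exact/subsetPset/ndF/leq_maxl.
  - by move: (x) Gx; exact/subsetPset/ndG/leq_maxr.
move=> k; have [mF Fk] := Foo k; have [mG Gk] := Goo k; split.
  by rewrite -[X in measurable X]setTI; apply: msplit => //; exact: measurableX.
rewrite /borel_lebesgueS /pushforward -comp_preimage.
rewrite (_ : split_rV \o _ = id).
  by rewrite preimage_id product_measure1E// lte_mul_pinfty// ge0_fin_numE.
by apply/funext => p /=; rewrite split_consK.
Qed.

HB.instance Definition _ := @Measure_isSigmaFinite.Build _ _ _
  borel_lebesgueS muS_sigma_finite.

End step.

Fixpoint borel_lebesgue n : {sigma_finite_measure set 'rV[R]_n -> \bar R} :=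
  if n is m.+1 then borel_lebesgueS (borel_lebesgue m)
  else \d_(0 : 'rV[R]_0).

End borel_lebesgue.

Section lebesgue.
Context {R : realType}.

(* The Caratheodory-measurable sets of the outer measure induced by the Borel
   measure are the Lebesgue-measurable sets; lebesgue is the completion. *)
Definition lebesgue_rV (d : nat) : measurableType _ :=
  caratheodory_type ((@borel_lebesgue R d)^*)%mu.

Definition lebesgue (d : nat) : set (lebesgue_rV d) -> \bar R :=
  @completed_measure_extension _ _ _ (@borel_lebesgue R d).

HB.instance Definition _ d := Measure.on (@lebesgue d).

HB.instance Definition _ d := @Measure_isSigmaFinite.Build _ _ _ (@lebesgue d)
  (completed_measure_extension_sigma_finite
    (sigma_finiteT (@borel_lebesgue R d))).

Definition lebesgue_measurable (A : set R) :=
  ((@wlength R idfun)^*)%mu.-cara.-measurable A.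

End lebesgue.
Arguments lebesgue_rV : clear implicits.
Arguments lebesgue : clear implicits.

Section invariant_measure.
Context {R : realType} {d : nat}.
Implicit Types (f phi sigma : 'rV[R]_d -> R) (b F : 'rV[R]_d -> 'rV[R]_d).

Definition Linfty_loc f :=
  measurable_fun [set: lebesgue_rV R d] (f : lebesgue_rV R d -> R) /\
  forall K : set 'rV[R]_d, compact K -> exists M : R,
    {ae lebesgue R d, forall x : 'rV[R]_d, K x -> `|f x| <= M}.

(* Elements of L^oo_loc are classes of functions modulo equality a.e.;
   periodicity is therefore required a.e., too. *)
Definition Y_periodic f := forall kappa : 'rV[int]_d,
  {ae lebesgue R d, forall x : 'rV[R]_d, f (x + map_mx intr kappa) = f x}.

Definition Linfty_per f := Linfty_loc f /\ Y_periodic f.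

Definition partial (i : 'I_d) phi : 'rV[R]_d -> R :=
  fun x => 'D_(delta_mx ord0 i) phi x.

Definition smooth phi := forall s : seq 'I_d,
  let psi := foldr partial phi s in
  continuous psi /\
  forall (i : 'I_d) (x : 'rV[R]_d), derivable psi x (delta_mx ord0 i).

Definition test_function phi :=
  smooth phi /\ compact (closure [set x | phi x != 0]).

(* <div F, phi> = - \int F . grad phi = 0 for every phi in C_c^oo(R^d) *)
Definition distr_div_free F := forall phi, test_function phi ->
  (\int[lebesgue R d]_x (\sum_(i < d) F x ord0 i * partial i phi x)%:E = 0)%E.

Definition positive_invariant_measure b sigma :=
  [/\ Linfty_per sigma,
      {ae lebesgue R d, forall x : 'rV[R]_d, 0 < sigma x} &
      distr_div_free (fun x => sigma x *: b x)].

End invariant_measure.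

(* Main.v *)
From HB Require Import structures.
Require Import Defs.
From mathcomp Require Import all_boot all_order all_algebra.
From mathcomp Require Import all_classical all_reals all_analysis.
From mathcomp Require Import measurable_realfun.
From mathcomp Require Import ring lra.
Set Implicit Arguments.
Unset Strict Implicit.
Unset Printing Implicit Defensive.
Import Order.TTheory GRing.Theory Num.Theory.
Import numFieldNormedType.Exports.
Local Open Scope classical_set_scope.
Local Open Scope ring_scope.

(** Write F = sigma b, a bounded periodic field with div F = 0, and suppose that
    sigma > 0. Fix a smooth step S (0 on the left of 0, 1 on the right of 1) and
    the bump chi(s) = S(s + 1) - S(s), whose integer translates telescope to 1.
    The flux of F through the hyperplane x_k = t, weighted by chi, is
      G(t) = \int F_k(t, x') \prod_i chi(x'_i) dx'.

    The function G is constant. Indeed, test div F = 0 against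
    psi(x_k) \prod_(i <> k) chi(x_i). The k-th partial derivative contributes
    \int G psi'. The j-th one, for j <> k, contains
    chi'(x_j) = S'(x_j + 1) - S'(x_j), so it contributes the difference of two
    integrals that the translation by the basis vector e_j exchanges; as F_j is
    invariant under this translation, the contribution is 0
    ([integral_partial_periodic]). Hence \int G psi' = 0 for every such psi. But
    chi >= 0 and sigma > 0 make G positive almost everywhere on A and negative
    almost everywhere on B ([flux_gt0], [flux_lt0]), which is absurd.

    To conclude pointwise, take Lebesgue points a in A and b in B of G and
    psi(t) = S(c (t - a)) - S(c (t - b)). Then psi has compact support and
    psi' is the difference of two mollifiers of mass 1 concentrating at a and
    at b as c grows, so G a = G b in the limit ([lebesgue_pt_mollifier],
    [flux_eq]).

    Three ingredients make this rigorous. The measure on R^d is the completion of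
    a product measure built by splitting off the first coordinate repeatedly;
    Tonelli's theorem shows that any other coordinate can be split off instead
    ([ge0_integral_insert]), which gives the slicing along x_k and the invariance
    under translation by e_j. Fubini's theorem wants Borel functions, whereas the
    field is only Lebesgue measurable, so the components of F are replaced by
    bounded Borel functions supported in a cube that contains the supports of all
    the test functions and of their translates ([completion_measurable_fun_ae],
    [local_representative]). The step S is built from exp(-1/x), and all its
    relatives are kept in a class of functions closed under differentiation
    ([smooth_expr]), so that tensor products are visibly test functions. *)

(** * Slicing Lebesgue measure along a coordinate *)

Section slicing.
Context {R : realType}.

Lemma insert_coord_id (T : Type) n (k : 'I_n.+1) (t : T) (x : 'rV[T]_n) :
  insert_coord k t x ord0 k = t.
Proof. by rewrite mxE unlift_none. Qed.

Lemma insert_coord_lift (T : Type) n (k : 'I_n.+1) (t : T) (x : 'rV[T]_n) j :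
  insert_coord k t x ord0 (lift k j) = x ord0 j.
Proof. by rewrite mxE liftK. Qed.

Lemma insert_coord_lift0 (T : Type) n (k : 'I_n.+1) (s t : T) (x : 'rV[T]_n) :
  insert_coord (lift ord0 k) t (insert_coord ord0 s x : 'rV[T]_n.+1) =
  insert_coord ord0 s (insert_coord k t x : 'rV[T]_n.+1).
Proof.
apply/rowP => i; have [i' ->|->] := unliftP ord0 i; last first.
  rewrite insert_coord_id.
  have -> : ord0 = lift (lift ord0 k) ord0 :> 'I_n.+2 by exact/val_inj.
  by rewrite insert_coord_lift insert_coord_id.
rewrite insert_coord_lift; have [j ->|->] := unliftP k i'; last first.
  by rewrite !insert_coord_id.
rewrite insert_coord_lift.
have -> : lift ord0 (lift k j) = lift (lift ord0 k) (lift ord0 j) :> 'I_n.+2.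
  by apply/val_inj => /=; rewrite /bump/= !add1n addnS.
by rewrite !insert_coord_lift.
Qed.

Lemma measurable_insert_coord d (T : measurableType d) n (k : 'I_n.+1)
    (u : T -> measurableTypeR R) (v : T -> 'rV[R]_n) :
  measurable_fun setT u -> measurable_fun setT v ->
  measurable_fun setT (fun x => insert_coord k (u x) (v x) : 'rV[R]_n.+1).
Proof.
move=> mu mv; apply: measurable_fun_rV => i; have [j ->|->] := unliftP k i.
- under eq_fun do rewrite insert_coord_lift.
  exact: measurableT_comp (measurable_coord_rV j) mv.
- by under eq_fun do rewrite insert_coord_id.
Qed.

Local Open Scope ereal_scope.

(** Induction on the dimension: inserting the coordinate k' + 1 amounts to
    inserting k' behind the first coordinate, and Tonelli's theorem exchanges the
    two inserted variables. *)
Lemma ge0_integral_insert n (k : 'I_n.+1) (f : 'rV[R]_n.+1 -> \bar R) :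
  measurable_fun setT f -> (forall x, 0 <= f x) ->
  \int[borel_lebesgue n.+1]_x f x =
  \int[lebesgue_measure]_t \int[borel_lebesgue n]_x f (insert_coord k t x).
Proof.
have base m (g : 'rV[R]_m.+1 -> \bar R) : measurable_fun setT g ->
    (forall x, 0 <= g x) ->
    \int[borel_lebesgue m.+1]_x g x = \int[lebesgue_measure]_t
      \int[borel_lebesgue m]_x g (insert_coord ord0 t x).
  move=> mg g0.
  rewrite /= /borel_lebesgueS.
  rewrite (ge0_integral_pushforward (@measurable_cons_rV R m))//.
  rewrite preimage_setT fubini_tonelli1//; last by move=> x; exact: g0.
  exact: (measurableT_comp mg (@measurable_cons_rV R m)).
elim: n k f => [|n IH] k f mf f0.
  by rewrite (ord1 k); exact: base.
have [k' ->|->] := unliftP ord0 k; last exact: base.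
pose h (q : measurableTypeR R * measurableTypeR R * 'rV[R]_n) : \bar R :=
  f (insert_coord (lift ord0 k') q.1.2 (insert_coord ord0 q.1.1 q.2
    : 'rV[R]_n.+1)).
have mh : measurable_fun setT h.
  apply: (measurableT_comp mf); apply: measurable_insert_coord.
    exact: measurableT_comp measurable_snd measurable_fst.
  apply: measurable_insert_coord; last exact: measurable_snd.
  exact: measurableT_comp measurable_fst measurable_fst.
have mH : measurable_fun setT (fubini_F (borel_lebesgue n) h).
  by apply: measurable_fun_fubini_tonelli_F => // x; exact: f0.
rewrite (base _ _ mf f0).
transitivity (\int[lebesgue_measure]_s \int[lebesgue_measure]_t
    fubini_F (borel_lebesgue n) h (s, t)).
  apply: eq_integral => s _.
  have mfs : measurable_fun setT
      (fun x : 'rV[R]_n.+1 => f (insert_coord ord0 s x)).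
    by apply: (measurableT_comp mf); exact: measurable_insert_coord.
  rewrite (IH k' _ mfs (fun=> f0 _)).
  apply: eq_integral => t _; apply: eq_integral => x _.
  by rewrite /h/= insert_coord_lift0.
rewrite fubini_tonelli//; last first.
  by move=> x; apply: integral_ge0 => y _; exact: f0.
apply: eq_integral => t _; rewrite base//.
apply: (measurableT_comp mf).
exact: measurable_insert_coord.
Qed.


(** Both sides are differences of integrals of the positive and negative parts,
    to which Tonelli's theorem applies. *)
Lemma integral_insert n (k : 'I_n.+1) (f : 'rV[R]_n.+1 -> \bar R) :
  measurable_fun setT f ->
  \int[borel_lebesgue n.+1]_x f x =
  \int[lebesgue_measure \x borel_lebesgue n]_p f (insert_coord k p.1 p.2).
Proof.
have ge0 (g : 'rV[R]_n.+1 -> \bar R) :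
    measurable_fun setT g -> (forall x, 0 <= g x) ->
    \int[borel_lebesgue n.+1]_x g x =
    \int[lebesgue_measure \x borel_lebesgue n]_p g (insert_coord k p.1 p.2).
  move=> mg g0; rewrite (ge0_integral_insert k)// fubini_tonelli1//.
  by apply: (measurableT_comp mg); exact: measurable_insert_coord.
move=> mf; rewrite integralE [RHS]integralE.
rewrite (ge0 f^\+) ?(ge0 f^\-)//.
- by congr (_ - _); apply: eq_integral => p _; rewrite unlock.
- exact: measurable_funeneg.
- exact: measurable_funepos.
Qed.

Lemma integrable_insert n (k : 'I_n.+1) (f : 'rV[R]_n.+1 -> \bar R) :
  (borel_lebesgue n.+1).-integrable setT f ->
  (lebesgue_measure \x borel_lebesgue n)%E.-integrable setT
    (fun p => f (insert_coord k p.1 p.2)).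
Proof.
move=> /integrableP[mf foo]; apply/integrableP; split.
  by apply: (measurableT_comp mf); exact: measurable_insert_coord.
rewrite -(integral_insert k (f := fun x => `|f x|))//.
exact: measurableT_comp.
Qed.

(** By Tonelli's theorem, almost every slice of a Borel null set is null. *)
Lemma ae_insert n (k : 'I_n.+1) (P : 'rV[R]_n.+1 -> Prop) :
  {ae borel_lebesgue n.+1, forall x, P x} ->
  {ae lebesgue_measure, forall t : R,
    {ae borel_lebesgue n, forall x, P (insert_coord k t x)}}.
Proof.
move=> [N [mN N0 PN]].
have mNk t : measurable ((insert_coord k t : 'rV[R]_n -> 'rV[R]_n.+1) @^-1` N).
  rewrite -[X in measurable X]setTI.
  have : measurable_fun setT (insert_coord k t : 'rV[R]_n -> 'rV[R]_n.+1).
    exact: measurable_insert_coord.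
  exact.
have : \int[lebesgue_measure]_t `|borel_lebesgue n
    ((insert_coord k t : 'rV[R]_n -> 'rV[R]_n.+1) @^-1` N)| = 0.
  rewrite -N0 -[in RHS](setIT N) -integral_indic//.
  rewrite (ge0_integral_insert k); last 2 first.
  - exact/measurable_EFinP.
  - by move=> x; rewrite lee_fin.
  apply: eq_integral => t _; rewrite gee0_abs//.
  by rewrite -(setIT (_ @^-1` N)) -integral_indic// setIT; apply: eq_integral.
move=> /(ae_eq_integral_abs _ measurableT).
have mS : measurable_fun setT (fun t : measurableTypeR R => borel_lebesgue n
    ((insert_coord k t : 'rV[R]_n -> 'rV[R]_n.+1) @^-1` N)).
  under eq_fun => t.
    rewrite -(setIT (_ @^-1` _)) -integral_indic//.
    over.
  apply: (@measurable_fun_fubini_tonelli_F _ _ (measurableTypeR R) _ _ _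
    (fun p => (\1_N (insert_coord k p.1 p.2))%:E)) => //.
  apply/measurable_EFinP; apply: measurableT_comp => //.
  exact: measurable_insert_coord.
move=> /(_ mS); apply: filterS => t /(_ I) Nt0.
exists ((insert_coord k t : 'rV[R]_n -> 'rV[R]_n.+1) @^-1` N).
by split => // x nPx; apply: PN.
Qed.

End slicing.

(** * The completion of a measure *)

Section completion.
Local Open Scope ereal_scope.
Context d (T : measurableType d) (R : realType).
Variable mu : {measure set T -> \bar R}.

(** The hull is an intersection of countable covers whose masses approach the
    outer measure. *)
Lemma mu_ext_hull (X : set T) :
  exists B, [/\ measurable B, X `<=` B & mu B <= (mu^*)%mu X].
Proof.
have [Xoo|Xfin] := leP +oo ((mu^*)%mu X).
  by exists setT; split => //; exact: le_trans (leey _) Xoo.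
have fX : (mu^*)%mu X \is a fin_num.
  by rewrite ge0_fin_numE//; exact: mu_ext_ge0.
have /choice[C CP] (n : nat) : exists C, [/\ measurable C, X `<=` C &
    mu C <= (mu^*)%mu X + n.+1%:R^-1%:E].
  have n0 : (0 < n.+1%:R^-1 :> R)%R by rewrite invr_gt0.
  have [_ [F [mF XF] <-] /ltW FX] := lb_ereal_inf_adherent n0 fX.
  exists (\bigcup_k F k); split => //; first exact: bigcupT_measurable.
  apply: le_trans FX; apply: measure_sigma_subadditive => //.
  exact: bigcupT_measurable.
exists (\bigcap_n C n); split.
- by apply: bigcapT_measurable => n; have [] := CP n.
- by apply: sub_bigcap => n _; have [] := CP n.
- apply/lee_addgt0Pr => /= e e0.
  have [n _ ne] : exists2 n : nat, True & (n.+1%:R^-1 < e)%R.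
    have [N _ /(_ N (leqnn _))] := near_infty_natSinv_lt (PosNum e0).
    by exists N.
  have [mC _ muC] := CP n.
  apply: (@le_trans _ _ (mu (C n))).
    apply: le_measure; rewrite ?inE//.
      by apply: bigcapT_measurable => m; have [] := CP m.
    exact: bigcap_inf.
  by apply: le_trans muC _; rewrite leeD2l// lee_fin ltW.
Qed.

Let I : measurableType _ := caratheodory_type (mu^*)%mu.
Let nu : {measure set I -> \bar R} := @completed_measure_extension _ _ _ mu.

Lemma measurable_completion (A : set T) :
  measurable A -> measurable (A : set I).
Proof.
by move=> mA; apply: sub_caratheodory; exact: sub_sigma_algebra.
Qed.

Lemma completionE (A : set T) : measurable A -> nu A = mu A.
Proof. exact: measurable_mu_extE. Qed.

Lemma negligible_completion (A : set T) :
  nu.-negligible A <-> mu.-negligible A.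
Proof.
split=> -[N [mN N0 AN]].
- have [B [mB NB muB]] := mu_ext_hull N.
  exists B; split => //; last exact: subset_trans NB.
  apply/eqP; rewrite eq_le measure_ge0 andbT.
  by rewrite (le_trans muB)// -N0.
- exists N; split => //; first exact: measurable_completion.
  by rewrite completionE.
Qed.

Lemma measurable_fun_completion d' (U : measurableType d') (f : T -> U) :
  measurable_fun [set: T] f -> measurable_fun [set: I] f.
Proof.
move=> mf _ Y mY; apply: measurable_completion.
exact: mf.
Qed.

(** The identity pushes the completed measure forward to [mu]. *)
Lemma integral_completion (f : T -> \bar R) : measurable_fun [set: T] f ->
  \int[nu]_x f x = \int[mu]_x f x.
Proof.
have mid : measurable_fun [set: I] (id : I -> T).
  exact: measurable_fun_completion.
have ge0 (g : T -> \bar R) : measurable_fun setT g -> (forall x, 0 <= g x) ->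
    \int[nu]_x g x = \int[mu]_x g x.
  move=> mg g0; rewrite -[LHS](ge0_integral_pushforward mid nu measurableT)//.
  by apply: eq_measure_integral => A mA _; exact: completionE.
move=> mf; rewrite integralE [RHS]integralE.
rewrite (ge0 f^\+) ?(ge0 f^\-)//.
- exact: measurable_funeneg.
- exact: measurable_funepos.
Qed.

End completion.

Section borel_representative.
Local Open Scope ereal_scope.
Context d (T : measurableType d) (R : realType).
Variable mu : {sigma_finite_measure set T -> \bar R}.
Let I : measurableType _ := caratheodory_type (mu^*)%mu.
Let nu : {measure set I -> \bar R} := @completed_measure_extension _ _ _ mu.

(** Inside a set of finite measure, the completed measure is additive, so the
    excess of a hull of A over A is null; sigma-finiteness reduces to that case. *)
Lemma completion_measurable_ae (A : set I) : measurable A ->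
  exists B : set T, measurable B /\ {ae mu, forall x, A x <-> B x}.
Proof.
move=> mA; have [S ST mS] := sigma_finiteT mu.
have /choice[B BP] n : exists B : set T,
    [/\ measurable B, A `&` S n `<=` B & mu.-negligible (B `\` (A `&` S n))].
  have [mSn Sn] := mS n.
  have mSnI : measurable (S n : set I) by exact: measurable_completion.
  have mAS : measurable (A `&` S n : set I) by exact: measurableI.
  have [B [mB SB muB]] := mu_ext_hull mu (A `&` S n).
  exists B; split => //; apply/negligible_completion.
  have mBI : measurable (B : set I) by exact: measurable_completion.
  exists (B `\` (A `&` S n)); split => //; first exact: measurableD.
  have ASfin : nu (A `&` S n) < +oo.
    rewrite (@le_lt_trans _ _ (nu (S n)))//; last by rewrite completionE.
    by apply: le_measure; rewrite ?inE//; exact: subIsetr.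
  have Bfin : nu B < +oo.
    by rewrite completionE// (le_lt_trans muB).
  rewrite (@measureD _ _ _ nu)// setIC setIidl//.
  apply/eqP; rewrite eq_le; apply/andP; split.
    rewrite sube_le0; apply: le_trans muB.
    by rewrite le_eqVlt; apply/orP; left; apply/eqP; exact: completionE.
  rewrite sube_ge0 ?ge0_fin_numE ?ASfin//.
  by apply: le_measure; rewrite ?inE.
exists (\bigcup_n B n); split.
  by apply: bigcupT_measurable => n; have [] := BP n.
have : mu.-negligible (\bigcup_n (B n `\` (A `&` S n))).
  by apply: negligible_bigcup => n; have [] := BP n.
apply: negligibleS => x /= AB.
have [[n _ Bx]|nB] := pselect ((\bigcup_n B n) x).
  exists n => //; split => // -[Ax _]; apply: AB; split => // _.
  by exists n.
exfalso; apply: AB; split => // Ax.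
have [n _ Sx] : (\bigcup_n S n) x by rewrite -ST.
by exists n => //; have [_ + _] := BP n; apply.
Qed.

(** The level sets of f at rational heights are Borel up to a common null set.
    Setting f to 0 on a Borel null set that contains it makes the level sets at all
    heights Borel. *)
Lemma completion_measurable_fun_ae (f : I -> R) : measurable_fun setT f ->
  exists g : T -> R,
    measurable_fun setT g /\ {ae mu, forall x, f x = g x}.
Proof.
move=> mf.
have /choice[B BP] (q : rat) : exists B : set T, measurable B /\
    {ae mu, forall x, (ratr q < f x)%R <-> B x}.
  apply: (@completion_measurable_ae [set x | (ratr q < f x)%R]).
  rewrite -[X in measurable X]setTI.
  rewrite (_ : [set x | _] = f @^-1` `]ratr q, +oo[); last first.
    by apply/seteqP; split => x /=; rewrite in_itv/= andbT.
  by apply: mf => //; exact: measurable_itv.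
have [N [mN N0 PN]] :
    {ae mu, forall x, forall q : rat, (ratr q < f x)%R <-> B q x}.
  have : mu.-negligible (\bigcup_(n : nat)
      ~` [set x | forall q, unpickle n = Some q ->
      ((ratr q < f x)%R <-> B q x)]).
    apply: negligible_bigcup => n.
    case: (unpickle n) => [q|].
      by apply: negligibleS (BP q).2 => x /=; apply: contra_not => ? ? [<-].
    by apply: negligibleS (negligible_set0 _) => x /=; apply.
  apply: negligibleS => x /= /existsNP[q nq].
  exists (pickle q) => //= /(_ q); rewrite pickleK.
  by apply: contra_not nq => /(_ erefl).
have mBq q : measurable (B q) := (BP q).1.
pose g x : R := if x \in N then 0%R else f x.
exists g; split; last first.
  exists N; split => // x; rewrite /g /=; apply: contra_notP => Nx.
  by rewrite memNset.
move=> _; apply: (measurability _ (RGenOInfty.measurableE R)) => //.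
move=> _ [_ [r ->] <-]; rewrite setTI.
rewrite (_ : _ @^-1` _ = (\bigcup_(q : rat) if (r < ratr q)%R || (r == ratr q)
  then B q `\` N else set0) `|` (if (r < 0)%R then N else set0)).
  apply: measurableU; last by case: ifP.
  apply: bigcupT_measurable_rat => q.
  by case: ifP => // _; exact: measurableD.
apply/seteqP; split => x.
- rewrite /g /= in_itv/= andbT; case: ifPn => [/set_mem Nx r0|/negP nN rf].
    by right; rewrite r0.
  left; have [q qI] := rat_in_itvoo rf.
  move: qI; rewrite in_itv/= => /andP[rq qf]; exists q => //; rewrite rq/=.
  split; last by rewrite inE in nN.
  by have := contra_not (PN x); rewrite inE in nN => /(_ nN)/contrapT /(_ q) <-.
- move=> [[q _]|].
    case: ifPn => // rq [Bx Nx]; rewrite /g /= in_itv/= andbT memNset//.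
    have := contra_not (PN x) Nx => /contrapT /(_ q) [_ /(_ Bx)].
    by apply: le_lt_trans; case/orP: rq => [/ltW|/eqP ->].
  by case: ifPn => // r0 Nx; rewrite /g /= in_itv/= andbT mem_set.
Qed.

End borel_representative.

(** * Translations and cubes *)

Section translation.
Context {R : realType}.

Definition translate (c t : measurableTypeR R) : measurableTypeR R := t + c.

Lemma measurable_translate c : measurable_fun setT (translate c).
Proof. exact: measurable_funD. Qed.

HB.instance Definition _ c :=
  isMeasurableFun.Build _ _ _ _ (translate c) (measurable_translate c).

Local Open Scope ereal_scope.

Lemma lebesgue_measure_translate c (A : set R) : measurable A ->
  lebesgue_measure (translate c @^-1` A) = lebesgue_measure A.
Proof.
move=> mA; apply/esym.
apply: (@lebesgue_measure_unique R
  (pushforward lebesgue_measure (translate c))) => // _ [[a b] _ <-] /=.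
rewrite /pushforward.
have -> : translate c @^-1` `]a, b] = `](a - c)%R, (b - c)%R]%classic.
  by apply/seteqP; split => t /=; rewrite /translate !in_itv/= ltrBlDr lerBrDr.
rewrite !lebesgue_measure_itv/= !lte_fin ltrD2r -!EFinB.
by case: ifP => // _; rewrite opprB addrA subrK.
Qed.

Lemma ge0_integral_translate c (f : R -> \bar R) :
  measurable_fun setT f -> (forall t, 0 <= f t) ->
  \int[lebesgue_measure]_t f (t + c)%R = \int[lebesgue_measure]_t f t.
Proof.
move=> mf f0.
rewrite -[LHS](ge0_integral_pushforward (measurable_translate c) _ measurableT)//.
by apply: eq_measure_integral => A mA _; exact: lebesgue_measure_translate.
Qed.

Lemma insert_coord_translate n (k : 'I_n.+1) (t c : R) (x : 'rV[R]_n) :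
  (insert_coord k t x + c *: delta_mx ord0 k)%R = insert_coord k (t + c)%R x.
Proof.
apply/rowP => i; rewrite [LHS]mxE [X in (_ + X)%R]mxE [X in (_ * X)%R]mxE eqxx/=.
have [j ->|->] := unliftP k i.
  by rewrite !insert_coord_lift eq_sym (negbTE (neq_lift _ _)) mulr0 addr0.
by rewrite !insert_coord_id eqxx mulr1.
Qed.

Lemma measurable_rV_translate n (v : 'rV[R]_n) :
  measurable_fun setT (fun x : 'rV[R]_n => x + v)%R.
Proof.
apply: measurable_fun_rV => i; under eq_fun do rewrite mxE.
by apply: measurable_funD => //; exact: measurable_coord_rV.
Qed.

(** Splitting off the coordinate k reduces the claim to dimension one. *)
Lemma integral_rV_translate n (k : 'I_n.+1) (c : R) (f : 'rV[R]_n.+1 -> \bar R) :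
  measurable_fun setT f ->
  \int[borel_lebesgue n.+1]_x f (x + c *: delta_mx ord0 k)%R =
  \int[borel_lebesgue n.+1]_x f x.
Proof.
have ge0 (g : 'rV[R]_n.+1 -> \bar R) : measurable_fun setT g ->
    (forall x, 0 <= g x) ->
    \int[borel_lebesgue n.+1]_x g (x + c *: delta_mx ord0 k)%R =
    \int[borel_lebesgue n.+1]_x g x.
  move=> mg g0; rewrite (ge0_integral_insert k)//; last first.
    by apply: (measurableT_comp mg); exact: measurable_rV_translate.
  rewrite [RHS](ge0_integral_insert k mg g0).
  under eq_integral do under eq_integral do rewrite insert_coord_translate.
  rewrite (@ge0_integral_translate c
    (fun t => \int[borel_lebesgue n]_x g (insert_coord k t x)))//.
    apply: (@measurable_fun_fubini_tonelli_F _ _ (measurableTypeR R) _ _ _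
      (fun p => g (insert_coord k p.1 p.2))) => //.
    by apply: (measurableT_comp mg); exact: measurable_insert_coord.
  by move=> t; exact: integral_ge0.
move=> mf; rewrite integralE [RHS]integralE.
rewrite -(ge0 f^\+) -?(ge0 f^\-)//.
- by congr (_ - _); apply: eq_integral => p _; rewrite unlock.
- exact: measurable_funeneg.
- exact: measurable_funepos.
Qed.

Lemma ae_rV_translate n (k : 'I_n.+1) (c : R) (P : 'rV[R]_n.+1 -> Prop) :
  {ae borel_lebesgue n.+1, forall x, P x} ->
  {ae borel_lebesgue n.+1, forall x : 'rV[R]_n.+1,
    P (x + c *: delta_mx ord0 k)%R}.
Proof.
move=> [N [mN N0 PN]].
have mT := measurable_rV_translate (c *: delta_mx ord0 k : 'rV[R]_n.+1).
have mTN : measurable ((fun x => x + c *: delta_mx ord0 k)%R @^-1` N).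
  by rewrite -[X in measurable X]setTI; exact: mT.
exists ((fun x => x + c *: delta_mx ord0 k)%R @^-1` N); split => //.
  rewrite -N0 -[in RHS](setIT N) -integral_indic// -(setIT (_ @^-1` N)).
  rewrite -integral_indic// -[RHS](integral_rV_translate k c)//.
  exact/measurable_EFinP.
by move=> x nPx; exact: PN.
Qed.

Lemma measurable_cube n (J : set R) : measurable J ->
  measurable [set x : 'rV[R]_n | forall i, J (x ord0 i)].
Proof.
move=> mJ; rewrite (_ : [set x | _] =
    \bigcap_(i in [set: 'I_n]) ((fun x : 'rV[R]_n => x ord0 i) @^-1` J)).
  apply: fin_bigcap_measurable => // i _; rewrite -[X in measurable X]setTI.
  exact: measurable_coord_rV.
by apply/seteqP; split => x //= xJ i; [move=> _|]; exact: xJ.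
Qed.

Lemma borel_lebesgue_cube n (J : set R) : measurable J ->
  0 < lebesgue_measure J < +oo ->
  0 < borel_lebesgue n [set x : 'rV[R]_n | forall i, J (x ord0 i)] < +oo.
Proof.
move=> mJ /andP[J0 Joo]; elim: n => [|n /andP[IH0 IHoo]].
  rewrite /= diracE mem_set//=; last by case.
  by rewrite lte01 ltry.
rewrite /= /borel_lebesgueS /pushforward.
rewrite (_ : _ @^-1` _ = J `*` [set x : 'rV[R]_n | forall i, J (x ord0 i)]).
  rewrite product_measure1E//; last exact: measurable_cube.
  by rewrite mule_gt0//= lte_mul_pinfty// ge0_fin_numE.
apply/seteqP; split => -[t x] /=.
  move=> H; split; first by have := H ord0; rewrite insert_coord_id.
  by move=> i; have := H (lift ord0 i); rewrite insert_coord_lift.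
move=> [Jt Jx] i; have [j ->|->] := unliftP ord0 i.
  by rewrite insert_coord_lift.
by rewrite insert_coord_id.
Qed.

End translation.

(** * Smooth functions of one variable *)

Section smooth_functions.
Context {R : realType}.

(** The functions x^-m exp(-1/x), extended by 0; the powers are there because
    they make the family closed under differentiation up to linear combinations. *)
Definition flat (m : nat) (x : R) : R :=
  if 0 < x then x ^- m * expR (- x^-1) else 0.

(** A single term of the exponential series at 1/x bounds x^-m exp(-1/x). The
    quadratic bound is what makes [flat m] differentiable at 0. *)
Lemma flat_le_sqr m (x : R) : `|flat m x| <= (m.+2)`!%:R * x ^+ 2.
Proof.
rewrite /flat; case: ifPn => [x0|_]; last first.
  by rewrite normr0 mulr_ge0 ?sqr_ge0.
rewrite ger0_norm; last by rewrite mulr_ge0 ?expR_ge0// invr_ge0 exprn_ge0// ltW.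
have xm : 0 < x ^+ m by rewrite exprn_gt0.
have E : (x^-1) ^+ m.+2 / (m.+2)`!%:R <= expR x^-1.
  have := @expR_ge1Dxn R x^-1 m.+1; rewrite invr_ge0 => /(_ (ltW x0)).
  by apply: le_trans; rewrite lerDr.
have f0 : 0 < (m.+2)`!%:R :> R by rewrite ltr0n fact_gt0.
rewrite expRN ler_pdivrMr ?expR_gt0//.
have Cx0 : 0 <= (m.+2)`!%:R * x ^+ 2 by rewrite mulr_ge0 ?sqr_ge0.
apply: le_trans (ler_wpM2l Cx0 E).
rewrite exprVn -[m.+2]addn2 exprD le_eqVlt; apply/orP; left; apply/eqP.
field.
by rewrite !gt_eqF// addn2.
Qed.

Lemma is_derive_flat0 m : is_derive (0 : R) 1 (flat m) 0.
Proof.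
have H : (h^-1 *: (flat m (h *: 1 + 0) - flat m 0)) @[h --> 0^'] --> (0 : R).
  apply/cvgrPdist_le => e e0; near=> h.
  have h0 : h != 0 by near: h; exact: nbhs_dnbhs_neq.
  rewrite {2}/flat ltxx subr0 sub0r normrN addr0 [h *: 1]mulr1.
  rewrite normrM normfV ler_pdivrMl ?normr_gt0//.
  apply: (le_trans (flat_le_sqr m h)).
  rewrite -real_normK ?num_real// expr2 mulrCA ler_pM2l ?normr_gt0//.
  rewrite mulrC -ler_pdivlMr ?ltr0n ?fact_gt0//.
  by near: h; apply: dnbhs0_le; rewrite divr_gt0// ltr0n fact_gt0.
apply: DeriveDef; first by apply/cvg_ex; exists 0.
exact/cvg_lim.
Unshelve. all: by end_near. Qed.

Lemma is_derive_flat m (x : R) :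
  is_derive x 1 (flat m) (flat m.+2 x - m%:R * flat m.+1 x).
Proof.
have [x0|x0|->] := ltgtP x 0.
- rewrite /flat ltNge (ltW x0)/= mulr0 subr0.
  apply: (@near_eq_is_derive _ _ _ (cst 0)).
  by apply: filterS (lt_nbhsl x0) => y y0; rewrite /flat ltNge ltW.
- have xn0 : x != 0 by rewrite gt_eqF.
  apply: (@near_eq_is_derive _ _ _
      (fun y : R => (y ^+ m)^-1 * expR (- y^-1))).
    by apply: filterS (lt_nbhsr x0) => y y0; rewrite /flat y0.
  have dX : is_derive x 1 (fun y : R => y ^+ m) (m%:R * x ^+ m.-1).
    apply: DeriveDef; first exact: exprn_derivable.
    by rewrite exp_derive ![_ *: _]mulr1.
  have xm0 : x ^+ m != 0 by rewrite expf_neq0.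
  have dV := @is_deriveV _ (fun y => y ^+ m) x _ _ xm0 dX.
  have dI := @is_deriveV _ id x 1 1 xn0 (is_derive_id _ _).
  have dN := is_deriveN dI.
  have dE : is_derive x 1 (fun y : R => expR (- y^-1)) (x ^- 2 * expR (- x^-1)).
    have dC := @is_derive1_comp _ expR _ x _ _ (is_derive_expR _) dN.
    apply: (is_derive_eq dC).
    by rewrite [_ *: 1]mulr1 opprK mulrC.
  apply: (is_derive_eq (is_deriveM dV dE)).
  rewrite /flat x0 /GRing.scale/=.
  case: m {dX dV xm0} => [|m].
    by rewrite !(mul0r, mulr0, addr0, subr0) expr0 invr1 !mul1r.
  rewrite /= !exprSr; set e := expR _; set p := x ^+ m; set c := (m.+1%:R : R).
  have p0 : p != 0 by rewrite expf_neq0.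
  field.
  by rewrite xn0 p0.
- rewrite {2 3}/flat ltxx mulr0 subr0; exact: is_derive_flat0.
Qed.

(** Expressions whose derivatives are again expressions of the same kind, hence
    smooth functions; this replaces any bookkeeping of higher derivatives. Inversion
    and affine changes of variable are what the smooth step requires. *)
Inductive smooth_expr : (R -> R) -> Prop :=
| smooth_cst c : smooth_expr (fun=> c)
| smooth_flat m : smooth_expr (flat m)
| smooth_add f g : smooth_expr f -> smooth_expr g ->
    smooth_expr (fun x => f x + g x)
| smooth_mul f g : smooth_expr f -> smooth_expr g ->
    smooth_expr (fun x => f x * g x)
| smooth_inv f : smooth_expr f -> (forall x, f x != 0) ->
    smooth_expr (fun x => (f x)^-1)
| smooth_affine f a c : smooth_expr f -> smooth_expr (fun x => f (a * x + c)).

Lemma smooth_expr_derive f : smooth_expr f ->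
  exists g, smooth_expr g /\ forall x, is_derive x (1 : R) f (g x).
Proof.
elim=> {f} [c|m|f g sf [f' [sf' df]] sg [g' [sg' dg]]|
  f g sf [f' [sf' df]] sg [g' [sg' dg]]|f sf [f' [sf' df]] f0|
  f a c sf [f' [sf' df]]].
- by exists (fun=> 0); split; [exact: smooth_cst|move=> x; exact: is_derive_cst].
- exists (fun x => flat m.+2 x + - m%:R * flat m.+1 x); split.
    apply: smooth_add; first exact: smooth_flat.
    apply: smooth_mul; [exact: smooth_cst|exact: smooth_flat].
  by move=> x; rewrite mulNr; exact: is_derive_flat.
- exists (fun x => f' x + g' x); split; first exact: smooth_add.
  by move=> x; exact: is_deriveD.
- exists (fun x => f x * g' x + g x * f' x); split.
    by apply: smooth_add; exact: smooth_mul.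
  by move=> x; exact: is_deriveM.
- exists (fun x => -1 * ((f x)^-1 * (f x)^-1) * f' x); split.
    by apply: smooth_mul => //; apply: smooth_mul; [exact: smooth_cst|];
      apply: smooth_mul; exact: smooth_inv.
  move=> x; apply: (is_derive_eq (@is_deriveV _ f x _ _ (f0 x) (df x))).
  by rewrite [_ *: _]mulrC mulrC mulN1r -exprVn expr2.
- exists (fun x => a * f' (a * x + c)); split.
    by apply: smooth_mul; [exact: smooth_cst|exact: smooth_affine].
  move=> x; rewrite mulrC; apply: (@is_derive1_comp _ f (fun x => a * x + c)).
  have d1 := is_deriveZ a (is_derive_id x (1 : R)).
  apply: (is_derive_eq (is_deriveD d1 (is_derive_cst c x 1))).
  by rewrite addr0 [_ *: _]mulr1.
Qed.

(** The classical smooth step, which is 0 up to 0 and 1 from 1 on. *)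
Definition step (x : R) : R := flat 0 x * (flat 0 x + flat 0 (-1 * x + 1))^-1.

Lemma flat_gt0 m (x : R) : 0 < x -> 0 < flat m x.
Proof. by move=> x0; rewrite /flat x0 mulr_gt0 ?expR_gt0 ?invr_gt0 ?exprn_gt0. Qed.

Lemma flat_eq0 m (x : R) : x <= 0 -> flat m x = 0.
Proof. by move=> x0; rewrite /flat ltNge x0. Qed.

Lemma flat_ge0 m (x : R) : 0 <= flat m x.
Proof. by have [/flat_eq0->|/(flat_gt0 m)/ltW] := leP x 0. Qed.

Lemma step_den_gt0 (x : R) : 0 < flat 0 x + flat 0 (-1 * x + 1).
Proof.
have [x0|x0] := ltP 0 x; first by rewrite ltr_wpDr ?flat_ge0 ?flat_gt0.
by rewrite ltr_wpDl ?flat_ge0 ?flat_gt0// mulN1r addrC subr_gt0 (le_lt_trans x0).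
Qed.

Lemma smooth_step : smooth_expr step.
Proof.
apply: smooth_mul; first exact: smooth_flat.
apply: smooth_inv; last by move=> x; rewrite gt_eqF// step_den_gt0.
apply: smooth_add; first exact: smooth_flat.
exact: (smooth_affine (-1) 1 (smooth_flat 0)).
Qed.

Lemma step_eq0 (x : R) : x <= 0 -> step x = 0.
Proof. by move=> x0; rewrite /step flat_eq0 ?mul0r. Qed.

Lemma step_eq1 (x : R) : 1 <= x -> step x = 1.
Proof.
move=> x1; rewrite /step; have := step_den_gt0 x.
rewrite (@flat_eq0 0 (-1 * x + 1)); last by rewrite mulN1r addrC subr_le0.
by rewrite addr0 => f0; rewrite divff// gt_eqF.
Qed.

Lemma step_gt0 (x : R) : 0 < x -> 0 < step x.
Proof. by move=> x0; rewrite mulr_gt0 ?flat_gt0// invr_gt0 step_den_gt0. Qed.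

Lemma step_lt1 (x : R) : x < 1 -> step x < 1.
Proof.
move=> x1; rewrite /step ltr_pdivrMr ?step_den_gt0// mul1r ltrDl flat_gt0//.
by rewrite mulN1r addrC subr_gt0.
Qed.

End smooth_functions.

(** * Tensor products of smooth functions *)

Section tensor_products.
Context {R : realType}.

Lemma smooth_is_derive (f : R -> R) (x : R) : smooth_expr f ->
  is_derive x 1 f (derive1 f x).
Proof.
by move=> /smooth_expr_derive[g [_ /(_ x) df]]; rewrite derive1E derive_val.
Qed.

Lemma smooth_derive1 (f : R -> R) : smooth_expr f -> smooth_expr (derive1 f).
Proof.
move=> /smooth_expr_derive[g [sg df]].
rewrite (_ : derive1 f = g)//; apply/funext => x.
by rewrite derive1E derive_val.
Qed.

Lemma smooth_continuous (f : R -> R) : smooth_expr f -> continuous f.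
Proof.
move=> sf x; apply: differentiable_continuous; apply/derivable1_diffP.
by have [] := smooth_is_derive x sf.
Qed.

Lemma smooth_measurable (f : R -> R) : smooth_expr f -> measurable_fun setT f.
Proof. by move=> /smooth_continuous; exact: continuous_measurable_fun. Qed.

Lemma smooth_sub (f g : R -> R) : smooth_expr f -> smooth_expr g ->
  smooth_expr (fun x => f x - g x).
Proof.
move=> sf sg; rewrite (_ : (fun x => _) = (fun x => f x + -1 * g x)).
  by apply: smooth_add => //; apply: smooth_mul => //; exact: smooth_cst.
by apply/funext => x; rewrite mulN1r.
Qed.

Lemma derive1_eq0 (f : R -> R) (x : R) : (\near x, f x = 0) -> derive1 f x = 0.
Proof.
by move=> f0; rewrite derive1E (near_eq_derive _ (g := cst 0))// derive_cst.
Qed.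

Definition tensor n (u : 'I_n -> R -> R) (x : 'rV[R]_n) : R :=
  \prod_i u i (x ord0 i).

Lemma tensor_insert n (k : 'I_n.+1) (u : 'I_n.+1 -> R -> R) t (x : 'rV[R]_n) :
  tensor u (insert_coord k t x) = u k t * tensor (fun j => u (lift k j)) x.
Proof.
rewrite /tensor (bigD1_ord k)//= insert_coord_id; congr *%R.
by apply: eq_bigr => i _; rewrite insert_coord_lift.
Qed.

Lemma continuous_tensor n (u : 'I_n -> R -> R) :
  (forall i, continuous (u i)) -> continuous (tensor u).
Proof.
move=> cu x.
suff H s : continuous_at x
    (fun y : 'rV[R]_n => \prod_(i <- s) u i (y ord0 i)).
  exact: H.
elim: s => [|i s IH].
  rewrite (_ : (fun y => _) = cst 1); first exact: cst_continuous.
  by apply/funext => y; rewrite big_nil.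
rewrite (_ : (fun y => _) = (fun y : 'rV[R]_n => u i (y ord0 i)) \*
    (fun y : 'rV[R]_n => \prod_(j <- s) u j (y ord0 j))); last first.
  by apply/funext => y; rewrite big_cons.
apply: continuousM => //.
by apply: continuous_comp; [exact: coord_continuous|exact: cu].
Qed.

Lemma measurable_tensor n (u : 'I_n -> R -> R) :
  (forall i, measurable_fun setT (u i)) -> measurable_fun setT (tensor u).
Proof.
move=> mu; apply: measurable_prod => i _.
by apply: (measurableT_comp (mu i)); exact: measurable_coord_rV.
Qed.

Definition tensor_partial n (j : 'I_n) (u : 'I_n -> R -> R) : 'I_n -> R -> R :=
  fun i => if i == j then derive1 (u i) else u i.

Lemma smooth_tensor_partial n (j : 'I_n) (u : 'I_n -> R -> R) :
  (forall i, smooth_expr (u i)) -> forall i, smooth_expr (tensor_partial j u i).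
Proof.
by move=> su i; rewrite /tensor_partial; case: ifP => // _; exact: smooth_derive1.
Qed.

Lemma is_derive_tensor n (j : 'I_n) (u : 'I_n -> R -> R) (x : 'rV[R]_n) :
  (forall i, smooth_expr (u i)) ->
  is_derive x (delta_mx ord0 j) (tensor u) (tensor (tensor_partial j u) x).
Proof.
move=> su; pose c : R := \prod_(i | i != j) u i (x ord0 i).
have uE h : tensor u (h *: delta_mx ord0 j + x) = u j (h *: 1 + x ord0 j) * c.
  rewrite /tensor (bigD1 j)//= !mxE !eqxx; congr (u j _ * _).
  apply: eq_bigr => i ij; rewrite !mxE (negbTE ij) andbF mulr0 add0r//.
have H : (h^-1 *: (tensor u (h *: delta_mx ord0 j + x) - tensor u x))
    @[h --> 0^'] --> tensor (tensor_partial j u) x.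
  rewrite (_ : (fun h => _) =
    fun h => h^-1 *: (u j (h *: 1 + x ord0 j) - u j (x ord0 j)) * c); last first.
    apply/funext => h; rewrite uE (_ : tensor u x = u j (x ord0 j) * c).
      by rewrite -mulrBl scalerAl.
    by rewrite /tensor (bigD1 j).
  rewrite (_ : tensor _ x = derive1 (u j) (x ord0 j) * c); last first.
    rewrite /tensor (bigD1 j)//= /tensor_partial eqxx; congr *%R.
    by apply: eq_bigr => i /negbTE ->.
  apply: cvgM; last exact: cvg_cst.
  have [d1 d2] := smooth_is_derive (x ord0 j) (su j).
  by rewrite -d2; exact: d1.
apply: DeriveDef; first by apply/cvg_ex; eexists; exact: H.
exact/cvg_lim.
Qed.

Lemma partial_tensor n (j : 'I_n) (u : 'I_n -> R -> R) :
  (forall i, smooth_expr (u i)) ->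
  partial j (tensor u) = tensor (tensor_partial j u).
Proof.
move=> su; apply/funext => x; have := is_derive_tensor j x su => d.
by rewrite /partial derive_val.
Qed.

(** Iterated partial derivatives only replace the factors of a tensor product by
    their derivatives. *)
Lemma smooth_tensor n (u : 'I_n -> R -> R) :
  (forall i, smooth_expr (u i)) -> smooth (tensor u).
Proof.
move=> su s.
have [w [sw ->]] : exists w : 'I_n -> R -> R, (forall i, smooth_expr (w i)) /\
    foldr (fun i => partial i) (tensor u) s = tensor w.
  elim: s => [|i s [w [sw /= ->]]]; first by exists u.
  exists (tensor_partial i w); split; first exact: smooth_tensor_partial.
  exact: partial_tensor.
split; first by apply: continuous_tensor => i; exact: smooth_continuous.
by move=> i x; have [] := is_derive_tensor i x sw.
Qed.

Definition cube n (r : R) : set 'rV[R]_n :=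
  [set x | forall i, x ord0 i \in `[-r, r]].

Arguments cube n r : clear implicits.

Lemma compact_cube n (r : R) : compact (cube n r).
Proof.
apply: (@rV_compact R n (fun=> `[-r, r]%classic)) => i.
exact: segment_compact.
Qed.

Lemma tensor_eq0 n (u : 'I_n -> R -> R) (r : R) (x : 'rV[R]_n) :
  (forall i t, t \notin `[-r, r] -> u i t = 0) -> ~ cube n r x -> tensor u x = 0.
Proof.
move=> u0 /existsNP[i /negP xi]; rewrite /tensor (bigD1 i)//= u0 ?mul0r//.
Qed.

Lemma test_function_tensor n (u : 'I_n -> R -> R) (r : R) :
  (forall i, smooth_expr (u i)) ->
  (forall i t, t \notin `[-r, r] -> u i t = 0) -> test_function (tensor u).
Proof.
move=> su u0; split; first exact: smooth_tensor.
apply: (subclosed_compact _ (@compact_cube n r)); first exact: closed_closure.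
have : closed (cube n r).
  by apply: compact_closed (@compact_cube n r); exact: norm_hausdorff.
move=> /closure_id ->; apply: closureS => x /= /eqP ux.
by apply: contrapT => /(tensor_eq0 u0).
Qed.

Lemma derive1_eq0_out (f : R -> R) (r t : R) :
  (forall t, t \notin `[-r, r] -> f t = 0) -> t \notin `[-r, r] -> derive1 f t = 0.
Proof.
move=> f0; rewrite in_itv/= negb_and -!ltNge => rt; apply: derive1_eq0.
case/orP: rt => rt.
  by apply: filterS (lt_nbhsl rt) => y yr; apply: f0; rewrite in_itv/= leNgt yr.
apply: filterS (lt_nbhsr rt) => y yr; apply: f0.
by rewrite in_itv/= negb_and -!ltNge yr orbT.
Qed.

End tensor_products.
Arguments cube {R} n r.

(** * Approximation of a point value by mollifiers *)

Section support.
Local Open Scope ereal_scope.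
Context d (T : measurableType d) (R : realType).
Variables (mu : {measure set T -> \bar R}) (D : set T).

Lemma integral_support (f : T -> \bar R) : (forall x, ~ D x -> f x = 0) ->
  \int[mu]_x f x = \int[mu]_(x in D) f x.
Proof.
move=> f0; rewrite [RHS]integral_mkcond; apply: eq_integral => x _.
by rewrite patchE; case: ifPn => // /negP; rewrite inE => /f0.
Qed.

Lemma bounded_support_integrable (f : T -> R) (C : R) :
  measurable D -> mu D < +oo -> measurable_fun setT f ->
  (forall x, `|f x| <= C)%R -> (forall x, ~ D x -> f x = 0%R) ->
  mu.-integrable setT (EFin \o f).
Proof.
move=> mD muD mf fC f0.
rewrite (_ : EFin \o f = (EFin \o f) \_ D).
  apply/(integrable_mkcond _ mD).
  apply: measurable_bounded_integrable => //; first exact: measurable_funTS.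
  exists C; split; first exact: num_real.
  by move=> x Cx y _ /=; rewrite (le_trans (fC y))// ltW.
apply/funext => x; rewrite patchE; case: ifPn => // /negP; rewrite inE => /f0.
by move=> /= ->.
Qed.

End support.

Section mollification.
Context {R : realType}.

Lemma derive1_step_out (t : R) : t \notin `[0, 1] -> derive1 step t = 0.
Proof.
rewrite in_itv/= negb_and -!ltNge => /orP[t0|t1].
  apply: derive1_eq0; apply: filterS (lt_nbhsl t0) => y y0.
  by rewrite step_eq0// ltW.
rewrite derive1E (near_eq_derive _ (g := cst (1 : R))) ?derive_cst//.
by apply: filterS (lt_nbhsr t1) => y y1; rewrite step_eq1// ltW.
Qed.

Lemma derive1_step_bounded : exists M : R, forall t, `|derive1 step t| <= M.
Proof.
have c : continuous (fun t : R => `|derive1 step t|).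
  move=> t; apply: continuous_comp; last exact: norm_continuous.
  exact/smooth_continuous/smooth_derive1/smooth_step.
have [m _ mM] := EVT_max (@ler01 R) (continuous_subspaceT c).
exists `|derive1 step m| => t.
have [|t01] := boolP (t \in `[0, 1]); first exact: mM.
by rewrite derive1_step_out// normr0.
Qed.

(** The derivative of t |-> step (c (t - a)), a kernel of mass 1 supported in
    the interval from a to a + 1/c. *)
Definition mollifier (c a t : R) : R := c * derive1 step (c * t - c * a).

Lemma mollifier_out (c a t : R) :
  0 < c -> t \notin `[a, a + c^-1] -> mollifier c a t = 0.
Proof.
move=> c0 tI; rewrite /mollifier derive1_step_out ?mulr0//.
apply: contra tI; rewrite !in_itv/= -mulrBr pmulr_rge0// subr_ge0 => /andP[-> /=].
by rewrite -ler_pdivlMl// mulr1 lerBlDl.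
Qed.

Lemma smooth_mollifier c a : smooth_expr (mollifier c a).
Proof.
apply: smooth_mul; first exact: smooth_cst.
exact: (smooth_affine c (- (c * a)) (smooth_derive1 smooth_step)).
Qed.

Lemma measurable_mollifier c a : measurable_fun setT (mollifier c a).
Proof. exact: smooth_measurable (smooth_mollifier c a). Qed.

Lemma mollifier_le (c a t M : R) : 0 < c -> (forall t, `|derive1 step t| <= M) ->
  `|mollifier c a t| <= c * M.
Proof. by move=> c0 HM; rewrite normrM gtr0_norm// ler_pM2l. Qed.

Lemma is_derive_step_affine (c e t : R) :
  is_derive t 1 (fun t => step (c * t + e)) (c * derive1 step (c * t + e)).
Proof.
rewrite mulrC; apply: (@is_derive1_comp _ step (fun x => c * x + e)).
  exact/smooth_is_derive/smooth_step.
have d1 := is_deriveZ c (is_derive_id t (1 : R)).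
apply: (is_derive_eq (is_deriveD d1 (is_derive_cst e t 1))).
by rewrite addr0 [_ *: _]mulr1.
Qed.

Local Open Scope ereal_scope.

Lemma integral_mollifier (c a : R) : (1 <= c)%R ->
  \int[lebesgue_measure]_t (mollifier c a t)%:E = 1.
Proof.
move=> c1; have c0 : (0 < c)%R by rewrite (lt_le_trans _ c1).
rewrite (@integral_support _ (measurableTypeR R) _ _
  `[(a - 1)%R, (a + 1)%R]%classic); last first.
  move=> t tI; rewrite mollifier_out//; apply/negP => tc; apply: tI; move: tc.
  rewrite /= !in_itv/= => /andP[ta tc]; rewrite (le_trans _ ta) ?gerBl//=.
  by rewrite (le_trans tc)// lerD2l invf_le1.
have sk : smooth_expr (fun t => step (c * t + - (c * a))%R).
  exact: (smooth_affine c _ smooth_step).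
rewrite (@continuous_FTC2 _ _ (fun t => step (c * t + - (c * a))%R)).
- rewrite step_eq1; last by rewrite -mulrBr addrAC subrr add0r mulr1.
  rewrite step_eq0 ?sube0//.
  by rewrite -mulrBr addrAC subrr add0r mulrN1 oppr_le0 ltW.
- by rewrite ltrD2l gtrN.
- exact: continuous_subspaceT (smooth_continuous (smooth_mollifier c a)).
- split.
  + by move=> x _; have [] := is_derive_step_affine c (- (c * a)) x.
  + apply: cvg_at_right_filter; exact: (smooth_continuous sk).
  + apply: cvg_at_left_filter; exact: (smooth_continuous sk).
- move=> x _; have d := is_derive_step_affine c (- (c * a)) x.
  by rewrite derive1E derive_val.
Qed.

Lemma integrable_mollifierM (G : R -> R) (C c a : R) : (0 < c)%R ->
  measurable_fun setT G -> (forall t, `|G t| <= C)%R ->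
  lebesgue_measure.-integrable setT (fun t : R => (G t * mollifier c a t)%:E).
Proof.
move=> c0 mG GC; have [M HM] := derive1_step_bounded.
apply: (@bounded_support_integrable _ (measurableTypeR R) _ _
   `[a, (a + c^-1)%R]%classic
   (fun t : R => G t * mollifier c a t)%R (C * (c * M))).
- exact: measurable_itv.
- by rewrite /= lebesgue_measure_itv/=; case: ifP => _; rewrite -?EFinB ltry.
- by apply: measurable_funM => //; exact: measurable_mollifier.
- by move=> t; rewrite normrM ler_pM//; exact: mollifier_le.
- move=> t tI; rewrite mollifier_out ?mulr0//.
  by apply/negP => /tI.
Qed.

(** The support of the mollifier lies in the ball of radius 2/c around a, of
    measure 4/c, and its values are at most c M with M a bound of the derivative of
    [step]. So the error is at most 4 M times the mean of |G - G a| over that ball,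
    which tends to 0 at a Lebesgue point. *)
Lemma lebesgue_pt_mollifier (G : R -> R) (C a : R) :
  measurable_fun setT G -> (forall t, `|G t| <= C)%R -> lebesgue_pt G a ->
  (\int[lebesgue_measure]_t (G t * mollifier n.+1%:R a t)%:E) @[n --> \oo]
    --> (G a)%:E.
Proof.
move=> mG GC La; have [M HM] := derive1_step_bounded.
have M0 : (0 <= M)%R by rewrite (le_trans _ (HM 0%R)).
have bnd (c : R) : (1 <= c)%R ->
    `|\int[lebesgue_measure]_t (G t * mollifier c a t)%:E - (G a)%:E| <=
    (4 * M)%:E * davg G a (2 / c)%R.
  move=> c1; have c0 : (0 < c)%R by rewrite (lt_le_trans _ c1).
  have d0 : (0 < 2 / c)%R by rewrite divr_gt0.
  have -> : (G a)%:E = \int[lebesgue_measure]_t (G a * mollifier c a t)%:E.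
    under eq_integral do rewrite EFinM.
    rewrite integralZl//; last first.
      have := @integrable_mollifierM (cst 1%R) 1 c a c0.
      under eq_fun do rewrite mul1r.
      by apply => // t; rewrite normr1.
    by rewrite integral_mollifier// mule1.
  rewrite -integralB_EFin//; last 2 first.
  - exact: (integrable_mollifierM _ _ mG GC).
  - by apply: (@integrable_mollifierM (cst (G a)) `|G a|%R).
  apply: le_trans; first apply: le_abse_integral => //.
    apply: emeasurable_funB; apply/measurable_EFinP; apply: measurable_funM => //;
      exact: measurable_mollifier.
  have mball : measurable (ball a (2 / c)%R) by exact: measurable_ball.
  have lball : lebesgue_measure (ball a (2 / c)%R) = (4 / c)%:E.
    rewrite lebesgue_measure_ball ?ltW//; congr (_%:E).
    by rewrite -mulrnAl -mulr_natr -natrM.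
  rewrite (@integral_support _ (measurableTypeR R) _ _ (ball a (2 / c)%R)); last first.
    move=> t ta; rewrite mollifier_out ?mulr0 ?subee ?abse0//.
    apply/negP => tc; apply: ta; move: tc.
    rewrite ball_itv /= !in_itv/= => /andP[ta tc].
    rewrite (lt_le_trans _ ta) ?gtrBl//= (le_lt_trans tc)// ltrD2l.
    by rewrite ltr_pMl ?invr_gt0// ltr1n.
  apply: (@le_trans _ _ (\int[lebesgue_measure]_(t in ball a (2 / c)%R)
      ((c * M)%:E * `|((center (G a) \o G) t)%:E|))).
    have mc : measurable_fun setT (center (G a) \o G).
      by apply: measurable_funB.
    apply: ge0_le_integral => //.
    - apply: measurableT_comp => //; apply: measurable_funTS.
      apply: emeasurable_funB; apply/measurable_EFinP; apply: measurable_funM => //;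
        exact: measurable_mollifier.
    - apply: measurable_funeM; apply: measurableT_comp => //.
      by apply/measurable_EFinP; apply: measurable_funTS.
    - move=> t _; rewrite -EFinB -mulrBl !abse_EFin -EFinM lee_fin normrM mulrC.
      by rewrite ler_wpM2r//; exact: mollifier_le.
  rewrite ge0_integralZl//; last 2 first.
  - apply: measurableT_comp => //; apply/measurable_EFinP; apply: measurable_funTS.
    exact: measurable_funB.
  - by rewrite lee_fin mulr_ge0// ltW.
  rewrite /davg /iavg lball inver gt_eqF ?divr_gt0// muleA -EFinM.
  rewrite le_eqVlt; apply/orP; left; apply/eqP; congr (_%:E * _).
  by field; rewrite gt_eqF//.
(* The radii tend to 0 from the right, as the definition of a Lebesgue point
   requires. *)
have rad : (2 / n.+1%:R : R)%R @[n --> \oo] --> (0 : R)^'+.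
  have H : (2 / n.+1%:R : R)%R @[n --> \oo] --> (0 : R)%R.
    rewrite -(mulr0 (2 : R)%R); apply: cvgM; first exact: cvg_cst.
    exact: cvg_harmonic.
  move=> P /H HP; apply: (@filterS _ \oo _ _ _ _ HP) => n /=; apply.
  exact: divr_gt0.
apply/sube_cvg0 => //; apply/cvg_abse0P.
apply: (@squeeze_cvge _ _ _ _ (cst 0) _
  (fun n => (4 * M)%:E * davg G a (2 / n.+1%:R)%R)).
- by apply: nearW => n; rewrite abse_ge0/=; apply: bnd; rewrite ler1n.
- exact: cvg_cst.
- rewrite -(mule0 (4 * M)%:E); apply: cvgeZl => //.
  exact: (cvg_comp _ _ rad La).
Qed.

End mollification.

(** * Bounded fields supported in a cube *)

Section flux.
Context {R : realType}.

Lemma measurable_cube_itv n (r : R) : measurable (cube n r).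
Proof.
apply: (@measurable_cube R n `[-r, r]%classic).
exact: measurable_itv.
Qed.

Lemma borel_lebesgue_cube_fin n (r : R) :
  0 < r -> (borel_lebesgue n (cube n r) < +oo)%E.
Proof.
move=> r0; have J : (0 < lebesgue_measure `[(- r)%R, r]%classic < +oo)%E.
  rewrite lebesgue_measure_itv/= lte_fin gtrN// -EFinB opprK ltry lte_fin.
  by rewrite addr_gt0.
by have /andP[_] := borel_lebesgue_cube n (measurable_itv _) J.
Qed.

Lemma continuous_bounded_cube n (r : R) (V : 'rV[R]_n -> R) : continuous V ->
  exists M, forall x, cube n r x -> `|V x| <= M.
Proof.
move=> cV.
have [M [_ HM]] := compact_bounded
  (continuous_compact (continuous_subspaceT cV) (@compact_cube R n r)).
exists (M + 1) => x cx; apply: (HM (M + 1)); first by rewrite ltrDl.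
by exists x.
Qed.

Lemma measurable_continuous_tensor n (u : 'I_n -> R -> R) :
  (forall i, continuous (u i)) -> measurable_fun setT (tensor u).
Proof.
move=> cu; apply: measurable_tensor => i; exact: continuous_measurable_fun.
Qed.

Lemma integrable_local_tensor n (r C : R) (H : 'rV[R]_n -> R) (u : 'I_n -> R -> R) :
  0 < r -> measurable_fun setT H -> (forall x, `|H x| <= C) ->
  (forall x, ~ cube n r x -> H x = 0) -> (forall i, continuous (u i)) ->
  (borel_lebesgue n).-integrable setT (fun x => (H x * tensor u x)%:E).
Proof.
move=> r0 mH HC H0 cu.
have [M HM] := continuous_bounded_cube r (continuous_tensor cu).
have C0 : 0 <= C by rewrite (le_trans _ (HC 0)).
apply: (@bounded_support_integrable _ _ _ _ (cube n r) (fun x => H x * tensor u x)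
  (C * `|M|)).
- exact: measurable_cube_itv.
- exact: borel_lebesgue_cube_fin.
- by apply: measurable_funM => //; exact: measurable_continuous_tensor.
- move=> x; rewrite normrM; have [cx|ncx] := pselect (cube n r x).
    by rewrite ler_pM// (le_trans (HM _ cx))// ler_norm.
  by rewrite H0// normr0 mul0r mulr_ge0.
- by move=> x /H0 ->; rewrite mul0r.
Qed.

(** The integer translates of chi telescope to 1. Likewise its derivative is the
    difference of two integer translates of one function, so that it integrates to 0
    against a function of period 1. (The factor 1 exhibits the change of variable as
    affine.) *)
Definition chi (t : R) : R := step (1 * t + 1) - step t.

Lemma smooth_chi : smooth_expr chi.
Proof. by apply: smooth_sub; [apply: smooth_affine|]; exact: smooth_step. Qed.

Lemma chi_out (t : R) : t \notin `[-1, 1] -> chi t = 0.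
Proof.
rewrite in_itv/= negb_and -!ltNge /chi mul1r => /orP[t1|t1].
  by rewrite !step_eq0 ?subrr//; lra.
by rewrite !step_eq1 ?subrr//; lra.
Qed.

Lemma chi_ge0 (t : R) : 0 <= chi t.
Proof.
rewrite /chi mul1r; have [t0|t0] := leP t 0.
  rewrite (step_eq0 t0) subr0; have [t1|t1] := leP (t + 1) 0.
    by rewrite step_eq0.
  by rewrite ltW// step_gt0.
rewrite (@step_eq1 _ (t + 1)); last by lra.
rewrite subr_ge0; have [t1|t1] := leP 1 t; first by rewrite step_eq1.
by rewrite ltW// step_lt1.
Qed.

Lemma chi_gt0 (t : R) : t \in `]-1, 1[ -> 0 < chi t.
Proof.
rewrite in_itv/= /chi mul1r => /andP[tN1 t1]; rewrite subr_gt0.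
have [t0|t0] := leP t 0; first by rewrite (step_eq0 t0) step_gt0//; lra.
by rewrite (@step_eq1 _ (t + 1)) ?step_lt1//; lra.
Qed.

Lemma derive1_chi (t : R) : derive1 chi t = derive1 step (t + 1) - derive1 step t.
Proof.
have d1 := is_derive_step_affine 1 1 t.
have d2 := smooth_is_derive t smooth_step.
have d := is_deriveB d1 d2.
rewrite derive1E (_ : chi = (fun t : R => step (1 * t + 1)) - step)//.
by rewrite derive_val !mul1r.
Qed.

(** The partial derivative in the direction j is V(x + e_j) - V(x), where V has
    the derivative of [step] as its j-th factor. By translation invariance and by
    the invariance of H under e_j, both terms have the same integral against H. The
    side 2 leaves room for the translation: where V(x + e_j) does not vanish, both x
    and x + e_j lie in the cube. *)
Lemma integral_partial_periodic n (j : 'I_n.+1) (C : R) (H : 'rV[R]_n.+1 -> R)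
    (u : 'I_n.+1 -> R -> R) :
  measurable_fun setT H -> (forall x, `|H x| <= C) ->
  (forall x, ~ cube n.+1 2 x -> H x = 0) ->
  {ae borel_lebesgue n.+1, forall x : 'rV[R]_n.+1, cube n.+1 2 x ->
    cube n.+1 2 (x + delta_mx ord0 j) -> H (x + delta_mx ord0 j) = H x} ->
  (forall i, smooth_expr (u i)) ->
  (forall i t, t \notin `[-2, 2] -> u i t = 0) ->
  u j = chi ->
  (\int[borel_lebesgue n.+1]_x (H x * tensor (tensor_partial j u) x)%:E = 0)%E.
Proof.
move=> mH HC H0 Hper su u0 uj.
(* V is the tensor product of these factors. *)
pose v i := if i == j then derive1 step else u i.
have sv i : smooth_expr (v i).
  by rewrite /v; case: ifP => // _; exact/smooth_derive1/smooth_step.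
have cv i : continuous (v i) by exact: smooth_continuous.
have vE (x : 'rV[R]_n.+1) : tensor (tensor_partial j u) x =
    tensor v (x + delta_mx ord0 j) - tensor v x.
  pose c := \prod_(i | i != j) u i (x ord0 i).
  have vc (y : 'rV[R]_n.+1) : (forall i, i != j -> y ord0 i = x ord0 i) ->
      tensor v y = derive1 step (y ord0 j) * c.
    move=> yx; rewrite /tensor (bigD1 j)//= /v eqxx; congr *%R.
    by apply: eq_bigr => i ij; rewrite (negbTE ij) yx.
  rewrite !vc//; last by move=> i ij; rewrite !mxE (negbTE ij) andbF addr0.
  rewrite !mxE !eqxx -mulrBl -derive1_chi -uj.
  rewrite /tensor (bigD1 j)//= /tensor_partial eqxx; congr *%R.
  by apply: eq_bigr => i /negbTE ->.
have v_out (y : 'rV[R]_n.+1) : tensor v y != 0 ->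
    cube n.+1 2 y /\ cube n.+1 2 (y - delta_mx ord0 j).
  move=> vy; have vyi i : v i (y ord0 i) != 0.
    by apply: contra vy => /eqP vyi; rewrite /tensor (bigD1 i)//= vyi mul0r.
  have yj : y ord0 j \in `[0, 1].
    by apply: contraT => yj; have := vyi j; rewrite /v eqxx derive1_step_out ?eqxx.
  have yi i : i != j -> y ord0 i \in `[-2, 2].
    move=> ij; apply: contraT => yi; have := vyi i.
    by rewrite /v (negbTE ij) u0 ?eqxx.
  split=> i; rewrite ?mxE; have [->|ij] := eqVneq i j.
  - by move: yj; rewrite !in_itv/= => /andP[? ?]; apply/andP; split; lra.
  - exact: yi.
  - by move: yj; rewrite ?mxE ?eqxx !in_itv/= => /andP[? ?]; apply/andP; split; lra.
  - by rewrite ?mxE ?(negbTE ij) ?andbF subr0; exact: yi.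
have mv := measurable_continuous_tensor cv.
have iv := integrable_local_tensor (@ltr0Sn R 1) mH HC H0 cv.
have mHv : measurable_fun setT (fun x => (H x * tensor v x)%:E).
  by apply/measurable_EFinP; exact: measurable_funM.
have mTv : measurable_fun setT (fun x : 'rV[R]_n.+1 => tensor v (x + delta_mx ord0 j)).
  by apply: (measurableT_comp mv); exact: measurable_rV_translate.
have aeE : {ae borel_lebesgue n.+1, forall x : 'rV[R]_n.+1,
    H x * tensor v (x + delta_mx ord0 j) =
    H (x + delta_mx ord0 j) * tensor v (x + delta_mx ord0 j)}.
  apply: filterS Hper => x Hx.
  have [->|/v_out[c1 c2]] := eqVneq (tensor v (x + delta_mx ord0 j)) 0.
    by rewrite !mulr0.
  by rewrite Hx//; move: c2; rewrite addrK.
transitivity (\int[borel_lebesgue n.+1]_x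
    (H (x + delta_mx ord0 j) * tensor v (x + delta_mx ord0 j) - H x * tensor v x)%:E)%E.
  apply: ae_eq_integral => //.
  - apply/measurable_EFinP; apply: measurable_funM => //.
    apply: measurable_continuous_tensor => i.
    exact: (smooth_continuous (smooth_tensor_partial j su i)).
  - apply/measurable_EFinP; apply: measurable_funB; apply: measurable_funM => //.
    by apply: (measurableT_comp mH); exact: measurable_rV_translate.
  - by apply: filterS aeE => x Hx _; rewrite vE mulrBr Hx.
have TE (g : 'rV[R]_n.+1 -> \bar R) : measurable_fun setT g ->
    (\int[borel_lebesgue n.+1]_x g (x + delta_mx ord0 j)%R =
    \int[borel_lebesgue n.+1]_x g x)%E.
  by move=> mg; rewrite -(integral_rV_translate j 1 mg) scale1r.
have iTv : (borel_lebesgue n.+1).-integrable setT (fun x : 'rV[R]_n.+1 =>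
    (H (x + delta_mx ord0 j) * tensor v (x + delta_mx ord0 j))%:E).
  apply/integrableP; split.
    by apply: (measurableT_comp mHv); exact: measurable_rV_translate.
  rewrite (TE (fun x => `|(H x * tensor v x)%:E|)%E).
    by have /integrableP[] := iv.
  exact: measurableT_comp.
under eq_integral do rewrite EFinB.
rewrite integralB_EFin// (TE (fun x => (H x * tensor v x)%:E))// subee//.
exact: integrable_fin_num.
Qed.

End flux.

(** * The flux through hyperplanes *)

Lemma integral_gt0 d (T : measurableType d) (R : realType)
    (mu : {measure set T -> \bar R}) (B : set T) (f : T -> R) :
  mu.-integrable setT (EFin \o f) -> measurable B -> (0 < mu B)%E ->
  {ae mu, forall x, 0 <= f x /\ (B x -> 0 < f x)} ->
  (0 < \int[mu]_x (f x)%:E)%E.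
Proof.
move=> /integrableP[mf _] mB muB fB.
have -> : (\int[mu]_x (f x)%:E = \int[mu]_x `|(f x)%:E|)%E.
  apply: ae_eq_integral => //; first exact: measurableT_comp.
  by apply: filterS fB => x [f0 _] _ /=; rewrite ger0_norm.
rewrite lt0e integral_ge0// andbT; apply/eqP.
move=> /(ae_eq_integral_abs _ measurableT mf) f0.
have : mu.-negligible B.
  have : {ae mu, forall x, ~ B x}.
    apply: filterS2 fB f0 => x [_ fpos] /(_ I) fx0 /fpos.
    by case: fx0 => ->; rewrite ltxx.
  by apply: negligibleS => x Bx /=; exact.
by move=> /(measure_negligible mB) B0; rewrite B0 ltxx in muB.
Qed.

Section flux_function.
Context {R : realType}.
Variables (n : nat) (k : 'I_n.+1) (C : R) (H : 'rV[R]_n.+1 -> R).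
Hypotheses (mH : measurable_fun setT H) (HC : forall x, `|H x| <= C).
Hypothesis H0 : forall x, ~ cube n.+1 2 x -> H x = 0.

Let Chi : 'rV[R]_n -> R := tensor (fun=> chi).
Let slice (t : R) (x : 'rV[R]_n) : R := H (insert_coord k t x).

Let measurable_slice t : measurable_fun setT (slice t).
Proof. by apply: (measurableT_comp mH); exact: measurable_insert_coord. Qed.

Let slice0 t (x : 'rV[R]_n) : ~ cube n 2 x -> slice t x = 0.
Proof.
move=> cx; apply: H0 => ct; apply: cx => i.
by have := ct (lift k i); rewrite insert_coord_lift.
Qed.

Let continuous_chi : continuous (@chi R).
Proof. exact: (smooth_continuous (smooth_chi)). Qed.

Lemma integrable_slice t :
  (borel_lebesgue n).-integrable setT (fun x => (slice t x * Chi x)%:E).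
Proof.
apply: (@integrable_local_tensor R n 2 C) => //.
- by move=> x; exact: HC.
- exact: slice0.
Qed.

(** If H is the k-th component of a periodic field near the support of the weight,
    this is the flux of the field through one period of the hyperplane x_k = t,
    because the integer translates of the weight add up to 1. *)
Definition flux (t : R) : R :=
  \int[borel_lebesgue n]_x (slice t x * Chi x).

Let fluxE t : (flux t)%:E = (\int[borel_lebesgue n]_x (slice t x * Chi x)%:E)%E.
Proof. by rewrite fineK//; exact: integrable_fin_num (integrable_slice t). Qed.

Lemma measurable_flux : measurable_fun setT flux.
Proof.
apply/measurable_EFinP.
(* As H has bounded support, the constant 1 is an admissible factor in the
   direction k. *)
pose u (i : 'I_n.+1) := if i == k then cst 1 else @chi R.
have cu i : continuous (u i).
  by rewrite /u; case: ifP => // _; exact: cst_continuous.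
have /(integrable_insert k)/measurable_fubini_F :=
  integrable_local_tensor (@ltr0Sn R 1) mH HC H0 cu.
congr (measurable_fun _ _); apply/funext => t /=; rewrite fluxE.
apply: eq_integral => x _; rewrite tensor_insert /u eqxx mul1r.
congr (_ * _)%:E; apply: eq_bigr => i _.
by rewrite eq_sym (negbTE (neq_lift _ _)).
Qed.

Lemma flux_bounded : exists M, forall t, `|flux t| <= M.
Proof.
have [M HM] := continuous_bounded_cube 2
  (continuous_tensor (fun=> continuous_chi) : continuous Chi).
have C0 : 0 <= C by rewrite (le_trans _ (HC 0)).
have mc := @measurable_cube_itv R n 2.
exists (C * `|M| * fine (borel_lebesgue n (cube n 2))) => t.
rewrite -lee_fin -abse_EFin fluxE; apply: le_trans.
  apply: le_abse_integral => //.
  by have /integrableP[] := integrable_slice t.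
rewrite (@integral_support _ _ _ _ (cube n 2)); last first.
  by move=> x /slice0 ->; rewrite mul0r abse0.
rewrite EFinM fineK ?ge0_fin_numE ?borel_lebesgue_cube_fin//.
rewrite -integral_cst//; apply: ge0_le_integral => //.
- apply: measurableT_comp => //; apply: measurable_funTS.
  by have /integrableP[] := integrable_slice t.
- move=> x cx; rewrite abse_EFin lee_fin normrM ler_pM//; first exact: HC.
  by rewrite (le_trans (HM _ cx))// ler_norm.
Qed.

Lemma integral_flux (w : R -> R) : continuous w ->
  (\int[borel_lebesgue n.+1]_x
    (H x * tensor (fun i => if i == k then w else chi) x)%:E =
  \int[lebesgue_measure]_t (flux t * w t)%:E)%E.
Proof.
move=> cw; pose u (i : 'I_n.+1) := if i == k then w else chi.
have cu i : continuous (u i) by rewrite /u; case: ifP.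
have iu := integrable_local_tensor (@ltr0Sn R 1) mH HC H0 cu.
rewrite (integral_insert k (f := fun x => (H x * tensor u x)%:E)); last first.
  by have /integrableP[] := iu.
rewrite -(integral12_prod_meas1 (integrable_insert k iu)).
apply: eq_integral => t _; rewrite /fubini_F /= EFinM muleC fluxE.
rewrite -integralZl//; last exact: integrable_slice.
apply: eq_integral => x _; rewrite tensor_insert /u eqxx -EFinM mulrCA.
congr (_ * (_ * _))%:E; apply: eq_bigr => i _.
by rewrite eq_sym (negbTE (neq_lift _ _)).
Qed.

(** The weight is nonnegative, and positive on the open cube of half-side 1. *)
Lemma flux_gt0 t : t \in `[-2, 2] ->
  {ae borel_lebesgue n, forall x, cube n.+1 2 (insert_coord k t x) ->
    0 < H (insert_coord k t x)} -> 0 < flux t.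
Proof.
move=> t2 Hpos; rewrite -lte_fin fluxE.
pose I : set R := `]-1, 1[%classic.
have mI : measurable I by exact: measurable_itv.
pose B := [set x : 'rV[R]_n | forall i, I (x ord0 i)].
have B0 : (0 < borel_lebesgue n B)%E.
  have J : (0 < lebesgue_measure I < +oo)%E.
    have N11 : (-1 : R) < 1 by lra.
    by rewrite lebesgue_measure_itv/= lte_fin N11 -EFinB ltry lte_fin andbT; lra.
  by have /andP[] := borel_lebesgue_cube n mI J.
apply: (@integral_gt0 _ _ _ _ B) => //.
- exact: integrable_slice.
- exact: measurable_cube.
- have cubeI (x : 'rV[R]_n) : cube n 2 x -> cube n.+1 2 (insert_coord k t x).
    move=> cx i; have [j ->|->] := unliftP k i.
      by rewrite insert_coord_lift; exact: cx.
    by rewrite insert_coord_id.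
  have Chi0 x : 0 <= Chi x by apply: prodr_ge0 => i _; exact: chi_ge0.
  apply: filterS Hpos => x Hx; split.
    have [cx|/slice0 ->] := pselect (cube n 2 x); last by rewrite mul0r.
    by rewrite mulr_ge0// ltW// Hx//; exact: cubeI.
  move=> Bx; rewrite mulr_gt0//.
    apply/Hx/cubeI => i; have := Bx i; rewrite /I /= !in_itv/= => /andP[? ?].
    by apply/andP; split; lra.
  by apply: prodr_gt0 => i _; apply: chi_gt0; exact: Bx.
Qed.

End flux_function.

Section flux_sign.
Context {R : realType}.

Lemma flux_lt0 n (k : 'I_n.+1) (C : R) (H : 'rV[R]_n.+1 -> R) t :
  measurable_fun setT H -> (forall x, `|H x| <= C) ->
  (forall x, ~ cube n.+1 2 x -> H x = 0) -> t \in `[-2, 2] ->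
  {ae borel_lebesgue n, forall x, cube n.+1 2 (insert_coord k t x) ->
    H (insert_coord k t x) < 0} -> flux k H t < 0.
Proof.
move=> mH HC H0 t2 Hneg; rewrite -oppr_gt0.
have -> : - flux k H t = flux k (fun x => - H x) t.
  rewrite -mulN1r /flux -RintegralZl//; last exact: integrable_slice mH HC H0 t.
  by apply: eq_Rintegral => x _; rewrite mulrA mulN1r.
apply: (@flux_gt0 _ _ _ C) => //.
- exact: measurableT_comp.
- by move=> x; rewrite normrN.
- by move=> x /H0 ->; rewrite oppr0.
- by apply: filterS Hneg => x Hx cx; rewrite oppr_gt0 Hx.
Qed.

(** The hypothesis says that the flux has the same mean against the mollifiers
    at a and at b; let their width tend to 0. *)
Lemma flux_eq n (k : 'I_n.+1) (C a b : R) (H : 'rV[R]_n.+1 -> R) :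
  measurable_fun setT H -> (forall x, `|H x| <= C) ->
  (forall x, ~ cube n.+1 2 x -> H x = 0) ->
  (forall c, 1 <= c -> (\int[borel_lebesgue n.+1]_x (H x *
    tensor (fun i => if i == k then (fun t => mollifier c a t - mollifier c b t)
                     else chi) x)%:E = 0)%E) ->
  lebesgue_pt (flux k H) a -> lebesgue_pt (flux k H) b ->
  flux k H a = flux k H b.
Proof.
move=> mH HC H0 Hc La Lb.
have mF := measurable_flux k mH HC H0.
have [M FM] := flux_bounded k mH HC H0.
have Fa := lebesgue_pt_mollifier mF FM La.
have Fb := lebesgue_pt_mollifier mF FM Lb.
have E :
  (fun m : nat =>
    \int[lebesgue_measure]_t (flux k H t * mollifier m.+1%:R a t)%:E)%E =
  (fun m : nat =>
    \int[lebesgue_measure]_t (flux k H t * mollifier m.+1%:R b t)%:E)%E; last first.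
  rewrite E in Fa.
  have la := cvg_lim (@ereal_hausdorff R) Fa.
  have lb := cvg_lim (@ereal_hausdorff R) Fb.
  by apply: EFin_inj; rewrite -la -lb.
apply/funext => m.
have ia := integrable_mollifierM a (@ltr0Sn R m) mF FM.
have ib := integrable_mollifierM b (@ltr0Sn R m) mF FM.
have fin_eq (x y : \bar R) : x \is a fin_num -> y \is a fin_num ->
    (x - y = 0)%E -> x = y.
  by move: x y => [x| |] [y| |]//= _ _ [] /eqP; rewrite subr_eq0 => /eqP ->.
apply: fin_eq; [exact: integrable_fin_num ia|exact: integrable_fin_num ib|].
rewrite -(integralB_EFin measurableT ia ib).
under eq_integral do rewrite -EFinB -mulrBr.
rewrite -(integral_flux k mH HC H0
  (w := fun t => mollifier m.+1%:R a t - mollifier m.+1%:R b t)).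
  by rewrite Hc// ler1n.
apply: smooth_continuous; apply: smooth_sub; exact: smooth_mollifier.
Qed.

End flux_sign.

(** * From the field to its flux *)

Section representatives.
Context {R : realType}.

Lemma ae_lebesgue d (P : 'rV[R]_d -> Prop) :
  {ae lebesgue R d, forall x, P x} <-> {ae borel_lebesgue d, forall x, P x}.
Proof. exact: negligible_completion. Qed.

Lemma integral_lebesgue d (f : 'rV[R]_d -> \bar R) : measurable_fun setT f ->
  (\int[lebesgue R d]_x f x = \int[borel_lebesgue d]_x f x)%E.
Proof. exact: integral_completion. Qed.

Lemma measurable_lebesgue d d' (U : measurableType d') (f : 'rV[R]_d -> U) :
  measurable_fun setT f -> measurable_fun [set: lebesgue_rV R d] f.
Proof. exact: measurable_fun_completion. Qed.

Lemma Linfty_perM d (f g : 'rV[R]_d -> R) : Linfty_per f -> Linfty_per g ->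
  Linfty_per (fun x => f x * g x).
Proof.
move=> [[mf bf] pf] [[mg bg] pg]; split; first split.
- exact: measurable_funM.
- move=> K cK; have [Mf /ae_lebesgue fM] := bf K cK.
  have [Mg /ae_lebesgue gM] := bg K cK.
  exists (Mf * Mg); apply/ae_lebesgue; apply: filterS2 fM gM => x fx gx Kx.
  by rewrite normrM ler_pM ?fx ?gx.
- move=> kappa; have /ae_lebesgue pfk := pf kappa; have /ae_lebesgue pgk := pg kappa.
  apply/ae_lebesgue; apply: filterS2 pfk pgk => x fx gx.
  by rewrite fx gx.
Qed.

(** Keep a Borel representative only on the part of the cube where the essential
    bound holds; this discards a null set. *)
Lemma local_representative d (r : R) (f : 'rV[R]_d -> R) : Linfty_loc f ->
  exists (H : 'rV[R]_d -> R) (C : R), [/\ measurable_fun setT H,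
    forall x, `|H x| <= C,
    forall x, ~ cube d r x -> H x = 0 &
    {ae borel_lebesgue d, forall x, cube d r x -> f x = H x}].
Proof.
move=> [mf bf]; have [g [mg fg]] := completion_measurable_fun_ae mf.
have [C /ae_lebesgue fC] := bf _ (@compact_cube R d r).
pose S : set 'rV[R]_d := cube d r `&` [set x | `|g x| <= C].
have mS : measurable S.
  apply: measurableI; first exact: measurable_cube_itv.
  rewrite (_ : [set x | _] = (fun x => `|g x|) @^-1` `]-oo, C]); last first.
    by apply/seteqP; split => x /=; rewrite in_itv.
  rewrite -[X in measurable X]setTI.
  by apply: (measurableT_comp _ mg) => //; exact: measurable_itv.
exists (fun x => \1_S x * g x), `|C|; split.
- exact: measurable_funM.
- move=> x; rewrite indicE; have [Sx|nSx] := pselect (S x).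
    by rewrite mem_set// mul1r (le_trans Sx.2)// ler_norm.
  by rewrite memNset// mul0r normr0.
- by move=> x cx; rewrite indicE memNset ?mul0r// => -[].
- have {}fg : {ae borel_lebesgue d, forall x, f x = g x} by exact: fg.
  apply: filterS2 fg fC => x fgx fCx cx; rewrite indicE mem_set ?mul1r//.
  by split => //=; rewrite -fgx; exact: fCx.
Qed.

End representatives.

Section divergence_free.
Context {R : realType}.

(** Otherwise A would be a subset of a null set, hence null for the completed
    measure. *)
Lemma exists_ae_in (A : set R) (P : R -> Prop) :
  (0 < completed_lebesgue_measure A)%E ->
  {ae lebesgue_measure, forall t : R, P t} -> exists t, A t /\ P t.
Proof.
move=> A0 aeP; apply: contrapT => nAP.
have /negligible_outer_measure AN : lebesgue_measure.-negligible A.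
  apply: negligibleS aeP => t At Pt; apply: nAP; by exists t.
by move: A0; rewrite [X in (0 < X)%E]AN ltxx.
Qed.

Lemma affine_diff_out (c a b t : R) : 1 <= c -> a \in `[0, 1] -> b \in `[0, 1] ->
  t \notin `[-2, 2] -> step (c * t + - (c * a)) - step (c * t + - (c * b)) = 0.
Proof.
move=> c1; rewrite !in_itv/= => /andP[a0 a1] /andP[b0 b1].
rewrite negb_and -!ltNge => tout.
have c0 : 0 < c by rewrite (lt_le_trans _ c1).
rewrite -!mulrBr; case/orP: tout => t2.
  by rewrite !step_eq0 ?subrr// pmulr_rle0//; lra.
by rewrite !step_eq1 ?subrr// (le_trans c1)// ler_peMr// ?ltW//; lra.
Qed.

Lemma derive1_affine_diff (c a b : R) :
  derive1 (fun t => step (c * t + - (c * a)) - step (c * t + - (c * b))) =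
  (fun t => mollifier c a t - mollifier c b t).
Proof.
apply/funext => t; rewrite derive1E.
have d := is_deriveB (is_derive_step_affine c (- (c * a)) t)
  (is_derive_step_affine c (- (c * b)) t).
by have [_ ->] := d.
Qed.

(** The test function is psi(x_k) times the chi(x_i), where
    psi(t) = step (c (t - a)) - step (c (t - b)) vanishes outside [-2, 2] because
    c >= 1 and a, b lie in [0, 1]. Periodicity cancels all the partial derivatives
    but the k-th one. *)
Lemma divergence_free_flux n (k : 'I_n.+1) (c a b : R)
    (F : 'rV[R]_n.+1 -> 'rV[R]_n.+1)
    (H : 'I_n.+1 -> 'rV[R]_n.+1 -> R) (C : 'I_n.+1 -> R) :
  (forall i, Linfty_per (fun x => F x ord0 i)) -> distr_div_free F ->
  (forall i, measurable_fun setT (H i)) -> (forall i x, `|H i x| <= C i) ->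
  (forall i x, ~ cube n.+1 2 x -> H i x = 0) ->
  (forall i, {ae borel_lebesgue n.+1, forall x,
    cube n.+1 2 x -> F x ord0 i = H i x}) ->
  1 <= c -> a \in `[0, 1] -> b \in `[0, 1] ->
  (\int[borel_lebesgue n.+1]_x (H k x *
    tensor (fun i => if i == k then (fun t => mollifier c a t - mollifier c b t)
                     else chi) x)%:E = 0)%E.
Proof.
move=> Fper divF mH HC H0 FH c1 a01 b01.
pose psi t := step (c * t + - (c * a)) - step (c * t + - (c * b)).
have dpsi : derive1 psi = (fun t => mollifier c a t - mollifier c b t).
  exact: derive1_affine_diff.
pose u (i : 'I_n.+1) := if i == k then psi else chi.
have su i : smooth_expr (u i).
  rewrite /u; case: ifP => _; last exact: smooth_chi.
  by apply: smooth_sub; apply: smooth_affine; exact: smooth_step.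
have u0 i t : t \notin `[-2, 2] -> u i t = 0.
  move=> t2; rewrite /u; case: ifP => _; first exact: affine_diff_out.
  rewrite chi_out//; apply: contra t2; rewrite !in_itv/= => /andP[? ?].
  by apply/andP; split; lra.
pose V i := tensor (tensor_partial i u).
have cV i j : continuous (tensor_partial i u j).
  exact: (smooth_continuous (smooth_tensor_partial i su j)).
have mV i : measurable_fun setT (V i) by exact: measurable_continuous_tensor.
have V0 i x : ~ cube n.+1 2 x -> V i x = 0.
  apply: tensor_eq0 => j t t2; rewrite /tensor_partial; case: ifP => _.
    by apply: derive1_eq0_out t2 => s; exact: u0.
  exact: u0.
have iHV i : (borel_lebesgue n.+1).-integrable setT (fun x => (H i x * V i x)%:E).
  exact: integrable_local_tensor (@ltr0Sn R 1) (mH i) (HC i) (@H0 i) (cV i).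
have mHV : measurable_fun setT (fun x => \sum_(i < n.+1) H i x * V i x).
  by apply: measurable_sum => i; exact: measurable_funM.
have mF i : measurable_fun [set: lebesgue_rV R n.+1] (fun x => F x ord0 i).
  by have [[m _] _] := Fper i; exact: m.
have mVl i : measurable_fun [set: lebesgue_rV R n.+1] (V i).
  exact: measurable_lebesgue (mV i).
have mFV : measurable_fun [set: lebesgue_rV R n.+1]
    (fun x => (\sum_(i < n.+1) F x ord0 i * V i x)%:E).
  apply/measurable_EFinP; apply: measurable_sum => i.
  exact: measurable_funM (mF i) (mVl i).
have mHVl : measurable_fun [set: lebesgue_rV R n.+1]
    (fun x => (\sum_(i < n.+1) H i x * V i x)%:E).
  apply/measurable_EFinP; exact: measurable_lebesgue mHV.
have FHV : {ae lebesgue R n.+1, forall x : lebesgue_rV R n.+1, setT x ->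
    (\sum_(i < n.+1) F x ord0 i * V i x)%:E =
    (\sum_(i < n.+1) H i x * V i x)%:E}.
  apply/ae_lebesgue.
  have FHall : {ae borel_lebesgue n.+1, forall x, forall i,
      cube n.+1 2 x -> F x ord0 i = H i x}.
    exact: filter_forall.
  apply: filterS FHall => x Fx _; congr (_%:E); apply: eq_bigr => i _.
  have [cx|/(V0 i) ->] := pselect (cube n.+1 2 x); first by rewrite Fx.
  by rewrite !mulr0.
have E := ae_eq_integral _ _ measurableT mFV mHVl FHV.
have := divF _ (test_function_tensor su u0).
under eq_integral do under eq_bigr do rewrite partial_tensor//.
rewrite -/V E integral_lebesgue; last exact/measurable_EFinP.
under eq_integral do rewrite -sumEFin.
rewrite integral_sum// (bigD1 k)//= big1 ?adde0; last first.
  move=> j jk; apply: (integral_partial_periodic (mH j) (HC j) (@H0 j) _ su u0).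
  - have FT := ae_rV_translate j 1 (FH j).
    have /ae_lebesgue Fj := (Fper j).2 (delta_mx ord0 j).
    have FHj := FH j.
    near=> x => cx cxT.
    have FTx : F (x + delta_mx ord0 j) ord0 j = H j (x + delta_mx ord0 j).
      have : cube n.+1 2 (x + 1 *: delta_mx ord0 j) ->
          F (x + 1 *: delta_mx ord0 j) ord0 j =
          H j (x + 1 *: delta_mx ord0 j) by near: x.
      by rewrite scale1r; apply.
    rewrite -FTx; have <- : F x ord0 j = H j x.
      by move: cx; near: x.
    have : F (x + map_mx intr (delta_mx ord0 j : 'rV[int]_n.+1)) ord0 j = F x ord0 j.
      by near: x.
    by rewrite map_delta_mx.
  - by rewrite /u (negbTE jk).
have -> : V k = tensor (fun i => if i == k then
    (fun t => mollifier c a t - mollifier c b t) else chi).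
  congr tensor; apply/funext => i; rewrite /tensor_partial /u.
  by case: (i == k); [exact: dpsi|reflexivity].
exact.
Unshelve. all: by end_near. Qed.

End divergence_free.

Theorem proposition3p1 (R : realType) (d : nat) (b : 'rV[R]_d -> 'rV[R]_d)
    (hb : forall i : 'I_d, Linfty_per (fun x => b x ord0 i))
    (k : 'I_d) (A B : set R)
    (hA01 : A `<=` `[0, 1]) (mA : lebesgue_measurable A)
    (hA0 : (0 < completed_lebesgue_measure A)%E)
    (hB01 : B `<=` `[0, 1]) (mB : lebesgue_measurable B)
    (hB0 : (0 < completed_lebesgue_measure B)%E)
    (hbA : forall xk : R, A xk -> {ae lebesgue R d.-1,
      forall x' : 'rV[R]_d.-1, 0 < b (insert_coord k xk x') ord0 k})
    (hbB : forall xk : R, B xk -> {ae lebesgue R d.-1,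
      forall x' : 'rV[R]_d.-1, b (insert_coord k xk x') ord0 k < 0}) :
  ~ exists sigma : 'rV[R]_d -> R, positive_invariant_measure b sigma.
Proof.
case=> sigma [sper spos divF].
case: d b hb k hbA hbB sigma sper spos divF => [|n] b hb k; first by case: k.
move=> hbA hbB sigma sper spos divF.
pose F x := sigma x *: b x.
have Fper i : Linfty_per (fun x => F x ord0 i).
  rewrite (_ : (fun x => _) = (fun x => sigma x * b x ord0 i)).
    exact: Linfty_perM.
  by apply/funext => x; rewrite mxE.
have /choice[H /choice[C HP]] i := local_representative 2 (Fper i).1.
have mH i : measurable_fun setT (H i) by have [] := HP i.
have HC i x : `|H i x| <= C i by have [_ + _ _] := HP i; apply.
have H0 i x : ~ cube n.+1 2 x -> H i x = 0 by have [_ _ + _] := HP i; apply.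
have FH i : {ae borel_lebesgue n.+1, forall x, cube n.+1 2 x ->
    F x ord0 i = H i x} by have [] := HP i.
have [M FM] := flux_bounded k (mH k) (HC k) (@H0 k).
have mF := measurable_flux k (mH k) (HC k) (@H0 k).
have aeL : {ae lebesgue_measure, forall t : R, lebesgue_pt (flux k (H k)) t}.
  apply: lebesgue_differentiation; split.
  - exact: mF.
  - exact: openT.
  - move=> K _ cK.
    have mK : measurable K by exact: compact_measurable.
    have Koo : (lebesgue_measure K < +oo)%E by exact: compact_finite_measure.
    have : lebesgue_measure.-integrable K (EFin \o flux k (H k)).
      apply: measurable_bounded_integrable => //; first exact: measurable_funTS.
      exists M; split; first exact: num_real.
      by move=> x Mx y _ /=; rewrite (le_trans (FM y))// ltW.
    by move=> /integrableP[].
pose good (t : R) := {ae borel_lebesgue n, forall x : 'rV[R]_n,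
  0 < sigma (insert_coord k t x) /\
  (cube n.+1 2 (insert_coord k t x) ->
   F (insert_coord k t x) ord0 k = H k (insert_coord k t x))}.
have aeS : {ae lebesgue_measure, forall t : R, good t}.
  apply: (ae_insert k (P := fun x => 0 < sigma x /\
    (cube n.+1 2 x -> F x ord0 k = H k x))).
  have /ae_lebesgue spos' := spos; have FHk := FH k.
  by apply: filterS2 spos' FHk => x.
have aeLS : {ae lebesgue_measure, forall t : R,
    lebesgue_pt (flux k (H k)) t /\ good t}.
  by apply: negligibleS (negligibleU aeL aeS) => t /= /not_andP.
have [a [Aa [La Sa]]] := exists_ae_in hA0 aeLS.
have [c [Bc [Lc Sc]]] := exists_ae_in hB0 aeLS.
have in2 (t : R) : `[0, 1]%classic t -> t \in `[-2, 2].
  by rewrite /= !in_itv/= => /andP[? ?]; apply/andP; split; lra.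
have Ga : 0 < flux k (H k) a.
  apply: (flux_gt0 (mH k) (HC k) (@H0 k) (in2 _ (hA01 _ Aa))).
  have /ae_lebesgue ba := hbA a Aa.
  apply: filterS2 Sa ba => x [sx Fx] bx cx.
  by rewrite -Fx// mxE mulr_gt0.
have Gc : flux k (H k) c < 0.
  apply: (flux_lt0 (mH k) (HC k) (@H0 k) (in2 _ (hB01 _ Bc))).
  have /ae_lebesgue bc := hbB c Bc.
  apply: filterS2 Sc bc => x [sx Fx] bx cx.
  by rewrite -Fx// mxE pmulr_rlt0.
have Eac : flux k (H k) a = flux k (H k) c.
  apply: (flux_eq (mH k) (HC k) (@H0 k) _ La Lc) => r r1.
  exact: (divergence_free_flux k Fper divF mH HC H0 FH r1 (hA01 _ Aa) (hB01 _ Bc)).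
by move: Ga; rewrite Eac => /lt_trans/(_ Gc); rewrite ltxx.
Qed.
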